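(* Let $k\ge 3$ be an integer, let $\lambda\in\mathbb{C}\setminus\{-n/2: n\in\mathbb{N}\}$, and let $\{p_n\}_{n\ge0}$ be the monic orthogonal polynomial sequence corresponding to the sieved ultraspherical polynomials of the first kind $\{c_n^\lambda(\cdot;k)\}_{n\ge0}$, i.e. $p_0=1$ and $$p_{kn+j+1}(x)=\frac{(1+2\lambda)_n}{2^{kn+j}(\lambda+1)_n}\,c^\lambda_{kn+j+1}(x;k)\qquad(n\ge 0,\ 0\le j\le k-1).$$ Let $\mathbf{u}$ be the regular functional with respect to which $\{p_n\}_{n\ge0}$ is an OPS, and put $u_n:=\langle \mathbf{u},x^n\rangle$. Then $$\mathbf{D}(\Phi\mathbf{u})=\Psi\mathbf{u},$$ where $\mathbf D$ is the distributional derivative and $$\Phi(x):=(1-x^2)\widehat U_{k-1}(x),\qquad \Psi(x):=-k(2\lambda+1)\widehat T_k(x).$$ Moreover, the formal Stieltjes series $S_{\mathbf u}(z):=-\sum_{n\ge0}u_n/z^{n+1}$ satisfies $$\Phi(z)S_{\mathbf u}'(z)=C(z)S_{\mathbf u}(z)+D(z),$$ where $C$ and $D$ are the polynomials $$C(z):=z\widehat U_{k-1}(z)-2k\lambda\widehat T_k(z),\qquad D(z):=-2k\lambda u_0\widehat U_{k-1}(z).$$ As a consequence, if $\lambda\in\mathbb{C}\setminus\{-n/2:n\in\mathbb{N}_0\}$ then $\{c_n^\lambda(\cdot;k)\}_{n\ge0}$ is a semiclassical OPS of class $k-1$. If $\lambda=0$, then $\{c_n^0(\cdot;k)\}_{n\ge0}$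 is, up to normalization, the Chebyshev OPS of the first kind, hence a classical OPS.
   Context: $\mathbb{N}=\{1,2,\dots\}$, $\mathbb{N}_0=\mathbb{N}\cup\{0\}$. $(\alpha)_0:=1$ and $(\alpha)_n:=\alpha(\alpha+1)\cdots(\alpha+n-1)$ for $n\ge1$. Chebyshev polynomials: $T_n(\cos\theta)=\cos n\theta$, $U_n(\cos\theta)=\sin((n+1)\theta)/\sin\theta$; monic versions $\widehat T_n:=2^{1-n}T_n$ and $\widehat U_n:=2^{-n}U_n$. Sieved ultraspherical polynomials of the first kind: the polynomials $C_n(x;\beta|q)$ are defined by $C_0(x;\beta|q)=1$, $C_1(x;\beta|q)=2x(1-\beta)/(1-q)$ and, for $n\ge 1$, $2x(1-\beta q^n)C_n=(1-q^{n+1})C_{n+1}+(1-\beta^2q^{n-1})C_{n-1}$, with $|q|<1$. They are renormalized as $C_n(x;\beta|q)=\frac{(\beta^2;q)_n}{(q;q)_n}c_n(x;\beta|q)$, where $(a;q)_n:=\prod_{j=1}^n(1-aq^{j-1})$; equivalently $c_0=1$, $c_1=2x/(1+\beta)$ and $2x(1-\beta q^n)c_n=(1-\beta^2q^n)c_{n+1}+(1-q^n)c_{n-1}$ for $n\ge1$ (this form is used also when $\beta=1$, i.e. $\lambda=0$). With $\omega_k:=e^{2\pi i/k}$, $c_n^\lambda(x;k):=\lim_{s\to1}c_n(x;s^{\lambda k}\,|\,s\omega_k)$ (limit over $s\in(0,1)$). Equivalently, the monic polynomials $p_n$ satisfy $p_0=1$, $p_1=x$, $p_{N+1}=xp_N-\gamma_Np_{N-1}$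 ($N\ge1$), where $\gamma_{mk}=\frac{m}{4(m+\lambda)}$ and $\gamma_{mk+1}=\frac{m+2\lambda}{4(m+\lambda)}$ for $m\ge1$, $\gamma_1=\frac12$, and $\gamma_N=\frac14$ for all other $N\ge1$. Let $\mathcal P$ be the space of complex polynomials. A linear functional $\mathbf u:\mathcal P\to\mathbb C$ is regular (quasi-definite) if there is a sequence $\{p_n\}_{n\ge0}$ with $\deg p_n=n$, $\langle\mathbf u,p_np_m\rangle=0$ for $n\ne m$ and $\langle\mathbf u,p_n^2\rangle\neq0$; then $\{p_n\}$ is an orthogonal polynomial sequence (OPS) with respect to $\mathbf u$ (and $\mathbf u$ is unique up to a nonzero constant factor). For $\phi\in\mathcal P$: $\langle\phi\mathbf u,p\rangle:=\langle\mathbf u,\phi p\rangle$ and $\langle\mathbf D\mathbf u,p\rangle:=-\langle\mathbf u,p'\rangle$. The OPS (and $\mathbf u$) is semiclassical if $\mathbf u$ is regular and $\mathbf D(\Phi\mathbf u)=\Psi\mathbf u$ for some nonzero polynomials $\Phi,\Psi$ with $\deg\Psi\ge1$; its class is the minimum of $\max\{\deg\Phi-2,\deg\Psi-1\}$ over all such pairs $(\Phi,\Psi)$. Classical means semiclassical of class $0$. *)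

(* Defs.v *)
From mathcomp Require Import all_boot all_order all_algebra.
From mathcomp Require Import all_classical all_reals all_analysis.
From mathcomp Require Import complex ring.

Set Implicit Arguments.
Unset Strict Implicit.
Unset Printing Implicit Defensive.

Import Order.TTheory GRing.Theory Num.Theory.
Import numFieldNormedType.Exports.

Local Open Scope ring_scope.
Local Open Scope classical_set_scope.

Definition pochhammer (F : fieldType) (a : F) (n : nat) : F :=
  \prod_(i < n) (a + i%:R).

Definition qpochhammer (F : fieldType) (a q : F) (n : nat) : F :=
  \prod_(i < n) (1 - a * q ^+ i).

(* Chebyshev polynomials, by the three-term recurrence; [chebT_cos] and
   [chebU_sin] are the trigonometric definitions. *)
Fixpoint chebT (F : fieldType) (n : nat) : {poly F} :=
  match n with
  | 0 => 1
  | (m.+1 as n').+1 => 2%:P * 'X * chebT F n' - chebT F m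
  | 1 => 'X
  end.

Fixpoint chebU (F : fieldType) (n : nat) : {poly F} :=
  match n with
  | 0 => 1
  | (m.+1 as n').+1 => 2%:P * 'X * chebU F n' - chebU F m
  | 1 => 2%:P * 'X
  end.

(* The exponent 1 - n is an integer, so that the formula also holds
   literally at n = 0. *)
Definition chebT_monic (F : fieldType) (n : nat) : {poly F} :=
  ((2 : F) ^ (1 - n%:Z)) *: chebT F n.

Definition chebU_monic (F : fieldType) (n : nat) : {poly F} :=
  (2 ^- n) *: chebU F n.

Lemma chebT_cos (R : realType) (n : nat) (t : R) :
  (chebT R[i] n).[(cos t)%:C%C] = (cos (n%:R * t))%:C%C.
Proof.
suff H m : (chebT R[i] m).[(cos t)%:C%C] = (cos (m%:R * t))%:C%C /\
   (chebT R[i] m.+1).[(cos t)%:C%C] = (cos (m.+1%:R * t))%:C%C by case: (H n).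
elim: m => [|m [IH1 IH2]].
  by split; rewrite /= ?mul0r ?cos0 ?mul1r !hornerE.
split=> //.
have -> : chebT R[i] m.+2 = 2%:P * 'X * chebT R[i] m.+1 - chebT R[i] m by [].
rewrite !hornerE IH1 IH2 -[2]/(2%:R) -(rmorph_nat (@real_complex R) 2).
rewrite -!rmorphM -rmorphB; congr (_%:C)%C.
have -> : m.+2%:R * t = m.+1%:R * t + t :> R by rewrite -!natr1; ring.
have -> : m%:R * t = m.+1%:R * t - t :> R by rewrite -!natr1; ring.
rewrite !cosD cosN sinN; ring.
Qed.

Lemma chebU_sin (R : realType) (n : nat) (t : R) : sin t != 0 ->
  (chebU R[i] n).[(cos t)%:C%C] = (sin (n.+1%:R * t) / sin t)%:C%C.
Proof.
move=> st0.
suff H m : (chebU R[i] m).[(cos t)%:C%C] = (sin (m.+1%:R * t) / sin t)%:C%C /\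
   (chebU R[i] m.+1).[(cos t)%:C%C] = (sin (m.+2%:R * t) / sin t)%:C%C
  by case: (H n).
elim: m => [|m [IH1 IH2]].
  split; rewrite /= !hornerE; first by rewrite ?mul1r divff.
  have -> : 2%:R * t = t + t by ring.
  rewrite sinD -[2]/(2%:R) -(rmorph_nat (@real_complex R) 2) -rmorphM.
  by congr (_%:C)%C; field.
split=> //.
have -> : chebU R[i] m.+2 = 2%:P * 'X * chebU R[i] m.+1 - chebU R[i] m by [].
rewrite !hornerE IH1 IH2 -[2]/(2%:R) -(rmorph_nat (@real_complex R) 2).
rewrite -!rmorphM -rmorphB; congr (_%:C)%C.
have -> : m.+3%:R * t = m.+2%:R * t + t :> R by rewrite -!natr1; ring.
have -> : m.+1%:R * t = m.+2%:R * t - t :> R by rewrite -!natr1; ring.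
by rewrite !sinD cosN sinN; field.
Qed.

(* C_n(x; beta | q) *)
Fixpoint qultra (F : fieldType) (beta q : F) (n : nat) : {poly F} :=
  match n with
  | 0 => 1
  | (m.+1 as n').+1 =>
      (1 - q ^+ n'.+1)^-1 *:
        ((2 * (1 - beta * q ^+ n')) *: ('X * qultra beta q n')
         - (1 - beta ^+ 2 * q ^+ m) *: qultra beta q m)
  | 1 => (2 * (1 - beta) / (1 - q)) *: 'X
  end.

(* c_n(x; beta | q), by its own recurrence, which unlike that of C_n still
   makes sense when beta = 1; see [qultraE] for the relation with C_n. *)
Fixpoint qultra_norm (F : fieldType) (beta q : F) (n : nat) : {poly F} :=
  match n with
  | 0 => 1
  | (m.+1 as n').+1 =>
      (1 - beta ^+ 2 * q ^+ n')^-1 *: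
        ((2 * (1 - beta * q ^+ n')) *: ('X * qultra_norm beta q n')
         - (1 - q ^+ n') *: qultra_norm beta q m)
  | 1 => (2 / (1 + beta)) *: 'X
  end.

Lemma qultraE (F : fieldType) (beta q : F) (n : nat) :
  (forall j : nat, 1 - q ^+ j.+1 != 0) ->
  (forall j : nat, 1 - beta ^+ 2 * q ^+ j != 0) ->
  qultra beta q n =
  (qpochhammer (beta ^+ 2) q n / qpochhammer q q n) *: qultra_norm beta q n.
Proof.
move=> hq hb.
have qpS a m : qpochhammer a q m.+1 = qpochhammer a q m * (1 - a * q ^+ m)
  by rewrite /qpochhammer big_ord_recr.
have nz m : qpochhammer q q m != 0.
  by apply/prodf_neq0 => i _; rewrite -exprS hq.
have b1 : 1 + beta != 0.
  have := hb 0; rewrite expr0 mulr1 (_ : 1 - _ = (1 - beta) * (1 + beta)); last by ring.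
  by rewrite mulf_eq0 negb_or => /andP[].
suff H m : qultra beta q m =
  (qpochhammer (beta ^+ 2) q m / qpochhammer q q m) *: qultra_norm beta q m /\
  qultra beta q m.+1 =
  (qpochhammer (beta ^+ 2) q m.+1 / qpochhammer q q m.+1)
     *: qultra_norm beta q m.+1 by case: (H n).
elim: m => [|m [IH1 IH2]].
  split; first by rewrite /qpochhammer !big_ord0 divr1 scale1r.
  rewrite !qpS /qpochhammer !big_ord0 /= scalerA expr0 !mul1r !mulr1.
  congr (_ *: _); have := hq 0; rewrite expr1 => h.
  by field; rewrite b1.
split=> //.
have -> : qultra beta q m.+2 = (1 - q ^+ m.+2)^-1 *:
        ((2 * (1 - beta * q ^+ m.+1)) *: ('X * qultra beta q m.+1)
         - (1 - beta ^+ 2 * q ^+ m) *: qultra beta q m) by [].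
have -> : qultra_norm beta q m.+2 = (1 - beta ^+ 2 * q ^+ m.+1)^-1 *:
        ((2 * (1 - beta * q ^+ m.+1)) *: ('X * qultra_norm beta q m.+1)
         - (1 - q ^+ m.+1) *: qultra_norm beta q m) by [].
rewrite IH1 IH2 -scalerAr !scalerBr !scalerA.
rewrite !qpS -!exprS.
have := nz m; have := hb m; have := hb m.+1; have := hq m; have := hq m.+1.
move=> h1 h2 h3 h4 h5.
by congr (_ *: _ - _ *: _); field; rewrite ?h1 ?h2 ?h3 ?h4 ?h5.
Qed.

Definition cexp (R : realType) (z : R[i]) : R[i] :=
  (expR (complex.Re z))%:C%C *
  (cos (complex.Im z) +i* sin (complex.Im z))%C.

(* s ^ z for real s > 0, principal branch *)
Definition cpow (R : realType) (s : R) (z : R[i]) : R[i] :=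
  cexp (z * (ln s)%:C%C).

Definition expi_root (R : realType) (k : nat) : R[i] :=
  cexp (0 +i* (2 * pi / k%:R))%C.

(* c_n^lambda(x; k): the polynomial which is the pointwise limit of
   c_n(x; s^(lambda k) | s omega_k) as s tends to 1 from the left. The
   default value 0 is for the case where no such polynomial exists. *)
Definition sieved1 (R : realType) (k : nat) (lambda : R[i]) (n : nat) :
    {poly R[i]} :=
  xget 0 [set c : {poly R[i]} | forall x : R[i],
    ((qultra_norm (cpow s (lambda * k%:R)) (s%:C%C * expi_root R k) n).[x]
       : R[i]^o) @[s --> (1 : R)^'-] --> (c.[x] : R[i]^o)].

Definition is_OPS (F : fieldType) (u : {scalar {poly F}})
    (p : nat -> {poly F}) : Prop :=
  [/\ forall n, size (p n) = n.+1,
      forall n m, n <> m -> u (p n * p m) = 0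
    & forall n, u (p n ^+ 2) != 0].

Definition regular (F : fieldType) (u : {scalar {poly F}}) : Prop :=
  exists p, is_OPS u p.

(* phi u *)
Definition pmulf (F : fieldType) (phi : {poly F}) (u : {poly F} -> F) :
  {poly F} -> F := fun p => u (phi * p).

(* D u *)
Definition derivf (F : fieldType) (u : {poly F} -> F) : {poly F} -> F :=
  fun p => - u (deriv p).

Definition pearson (F : fieldType) (u : {poly F} -> F) (Phi Psi : {poly F}) :
    Prop :=
  derivf (pmulf Phi u) =1 pmulf Psi u.

Definition semiclassical_pair (F : fieldType) (u : {poly F} -> F)
    (Phi Psi : {poly F}) : Prop :=
  [/\ Phi != 0, (1 < size Psi)%N & pearson u Phi Psi].

(* max {deg Phi - 2, deg Psi - 1}; as deg Psi >= 1, truncating the first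
   difference at 0 does not change the maximum. *)
Definition pair_class (F : fieldType) (Phi Psi : {poly F}) : nat :=
  maxn ((size Phi).-1 - 2) ((size Psi).-1 - 1).

Definition semiclassical_of_class (F : fieldType) (u : {scalar {poly F}})
    (s : nat) : Prop :=
  [/\ regular u,
      exists Phi Psi, semiclassical_pair u Phi Psi /\ pair_class Phi Psi = s
    & forall Phi Psi, semiclassical_pair u Phi Psi ->
        (s <= pair_class Phi Psi)%N].

Definition semiclassical_OPS (F : fieldType) (p : nat -> {poly F}) (s : nat) :
    Prop :=
  exists u : {scalar {poly F}}, is_OPS u p /\ semiclassical_of_class u s.

Definition classical_OPS (F : fieldType) (p : nat -> {poly F}) : Prop :=
  semiclassical_OPS p 0.

(* Formal series in z and 1/z: [f m] is the coefficient of z ^ m. Only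
   multiplication by polynomials is needed. *)
Definition fseries (F : fieldType) : Type := int -> F.

Definition fs_poly (F : fieldType) (p : {poly F}) : fseries F :=
  fun m => match m with Posz n => p`_n | Negz _ => 0 end.

Definition fs_add (F : fieldType) (f g : fseries F) : fseries F :=
  fun m => f m + g m.

Definition fs_pmul (F : fieldType) (p : {poly F}) (f : fseries F) :
  fseries F := fun m => \sum_(i < size p) p`_i * f (m - i%:Z).

Definition fs_deriv (F : fieldType) (f : fseries F) : fseries F :=
  fun m => (m + 1)%:~R * f (m + 1).

(* - sum_(n >= 0) <u, x^n> / z^(n+1); recall Negz n = - (n + 1). *)
Definition stieltjes (F : fieldType) (u : {poly F} -> F) : fseries F :=
  fun m => match m with Posz _ => 0 | Negz n => - u 'X^n end.

(* Main.v *)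
Require Import Defs.
From HB Require Import structures.
From mathcomp Require Import all_boot all_order all_algebra.
From mathcomp Require Import all_classical all_reals all_analysis.
From mathcomp Require Import complex ring zify.
Set Implicit Arguments.
Unset Strict Implicit.
Unset Printing Implicit Defensive.
Import Order.TTheory GRing.Theory Num.Theory.
Local Open Scope ring_scope.

(** Write c_n for the sieved polynomials, la for the parameter, T_(-n) = T_n,
and t for the angle with x = cos t.

The limit. The recurrence of c_n(x; beta | q) involves quotients (1 - s^b w) /
(1 - s^a w) with w the n-th power of exp (2 pi i / k). They tend to 1 unless w
= 1, i.e. unless k divides n, where they tend to b / a. Hence c_(n+1) = 2 x
c_n - c_(n-1) when k does not divide n, and (2 la + m) c_(n+1) = 2 (la + m) x
c_n - m c_(n-1) when n = m k ([sieved1E]).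

The expansion. Between two consecutive multiples of k the recurrence is
Chebyshev's, so for 0 <= r <= k the polynomial c_(m k + r) is a combination of
the T_(k (m - 2 i) + r) with coefficients that depend only on m and i; the
recurrence at the multiples of k gives them in closed form as products of
(la)_i / i! and (la + 1)_(m - i) / (m - i)! ([sieved_block]).

The functional. For positive la the weight is |sin (k t)|^(2 la) dt. Its
Chebyshev moments vanish except at multiples of 2 k, where they satisfy a
two-term relation with rational coefficients. These moments define a
functional v for every admissible la. It kills c_n when k does not divide n
because no multiple of k occurs as an index in the expansion, and it kills
c_(m k) by a symmetry of the sum ([v_edge]). So v is the functional of
orthogonality by [favard], and any other one is a multiple of v.

The equations. By the product formulas for sines and cosines, the Pearson
equation tested at T_n only involves the moments at n - k and n + k, and is
exactly the two-term relation ([pearson_of_cheb]). Every Pearson equation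
implies an equation Phi S' = C S + D with C = Psi - Phi' and D made of the
associated polynomials of Phi and Psi ([stieltjes_pearson]); since the
functional kills T_1, ..., T_(2 k - 1), these are the same as for the
Chebyshev weight, where the associated polynomial of T_n is U_(n-1).

The class. If la != 0, then C and D are coprime, by T_k^2 + (1 - x^2)
U_(k-1)^2 = 1. For another pair (Phi1, Psi1) one finds Phi1 C = Phi C1 and
Phi1 D = Phi D1, so Phi divides Phi1 and deg Phi1 - 2 >= k - 1 ([pearson_dvd],
[sieved_class_ge]). If la = 0, the recurrence is Chebyshev's at every index,
so c_n = T_n. *)

(** * Chebyshev polynomials with integer index *)

Section Chebyshev.
Variable F : numFieldType.
Implicit Types (n : int) (k m : nat) (p q : {poly F}).

(** Since T_n(cos t) = cos (n t), the index extends to all integers as an even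
function; all product formulas below then hold without case distinctions. *)
Definition chebTz n : {poly F} := chebT F `|n|%N.

(** The polynomial sin (k t) / sin t in x = cos t, that is U_(k-1), with the
value 0 at k = 0 that the recurrence forces. *)
Definition chebUp k : {poly F} := if k is m.+1 then chebU F m else 0.

Lemma chebTzN n : chebTz (- n) = chebTz n.
Proof. by rewrite /chebTz abszN. Qed.

Lemma chebTz_rec n : chebTz (n + 1) = 2%:P * 'X * chebTz n - chebTz (n - 1).
Proof.
have H m : chebTz (m%:Z + 1) = 2%:P * 'X * chebTz m - chebTz (m%:Z - 1).
  case: m => [|m].
    rewrite /chebTz /= mulr1 -[2%:P]/(2%:R%:P) polyC_natr; ring.
  have -> : m.+1%:Z + 1 = m.+2 by lia.
  have -> : m.+1%:Z - 1 = m by lia.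
  by [].
case: n => n; first exact: H.
have -> : chebTz (Negz n + 1) = chebTz (n.+1%:Z - 1)
  by rewrite -chebTzN; congr chebTz; lia.
have -> : chebTz (Negz n - 1) = chebTz (n.+1%:Z + 1)
  by rewrite -chebTzN; congr chebTz; lia.
have -> : chebTz (Negz n) = chebTz n.+1 by [].
rewrite H; ring.
Qed.

Lemma chebUp_rec k : chebUp k.+2 = 2%:P * 'X * chebUp k.+1 - chebUp k.
Proof. by case: k => [|k] //=; rewrite mulr1 subr0. Qed.

Lemma nat_ind2 (P : nat -> Prop) :
  P 0%N -> P 1%N -> (forall m, P m -> P m.+1 -> P m.+2) -> forall m, P m.
Proof.
move=> P0 P1 PS m; suff: P m /\ P m.+1 by case.
by elim: m => [//|m [? ?]]; split=> //; apply: PS.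
Qed.

(** 2 cos (k t) cos (n t) = cos ((n + k) t) + cos ((n - k) t). *)
Lemma chebT_mul k n : 2%:P * chebT F k * chebTz n =
  chebTz (n + k%:Z) + chebTz (n - k%:Z).
Proof.
elim/nat_ind2: k => [||k IH0 IH1].
- have -> : n + 0%:Z = n by lia.
  by rewrite /=; ring.
- by rewrite chebTz_rec /=; ring.
have -> : chebT F k.+2 = 2%:P * 'X * chebT F k.+1 - chebT F k by [].
have -> : n + k.+2%:Z = (n + k.+1%:Z) + 1 by lia.
have -> : n - k.+2%:Z = (n - k.+1%:Z) - 1 by lia.
have -> : chebTz (n - k.+1%:Z - 1) =
  2%:P * 'X * chebTz (n - k.+1%:Z) - chebTz (n - k.+1%:Z + 1).
  by rewrite chebTz_rec; ring.
rewrite chebTz_rec.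
have -> : n + k.+1%:Z - 1 = n + k%:Z by lia.
have -> : n - k.+1%:Z + 1 = n - k%:Z by lia.
have -> : 2%:P * (2%:P * 'X * chebT F k.+1 - chebT F k) * chebTz n =
  2%:P * 'X * (2%:P * chebT F k.+1 * chebTz n) - 2%:P * chebT F k * chebTz n by
    ring.
by rewrite IH0 IH1; ring.
Qed.

(** 2 sin t sin (m t) = cos ((m - 1) t) - cos ((m + 1) t), with the derivative
of T_m standing for m sin (m t) / sin t. *)
Lemma deriv_chebT_1 m :
  2%:P * (1 - 'X^2) * deriv (chebT F m) =
  m%:R%:P * (chebTz (m%:Z - 1) - chebTz (m%:Z + 1)).
Proof.
elim/nat_ind2: m => [||m IH0 IH1].
- by rewrite /= derivC mulr0 mul0r.
- rewrite /chebTz /= derivX.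
  ring.
have -> : deriv (chebT F m.+2) =
    2%:P * (chebT F m.+1 + 'X * deriv (chebT F m.+1)) - deriv (chebT F m).
  have -> : chebT F m.+2 = 2%:P * 'X * chebT F m.+1 - chebT F m by [].
  by rewrite derivB -mulrA derivM derivC mul0r add0r derivM derivX mul1r.
have -> : 2%:P * (1 - 'X^2) * (2%:P * (chebT F m.+1 + 'X * deriv (chebT F m.+1))
   - deriv (chebT F m)) =
  4%:R * (1 - 'X^2) * chebT F m.+1 + 2%:P * 'X * (2%:P * (1 - 'X^2) * deriv
    (chebT F m.+1)) - 2%:P * (1 - 'X^2) * deriv (chebT F m) by ring.
rewrite IH0 IH1.
have r1 : chebTz (m.+2%:Z + 1) = 2%:P * 'X * chebTz m.+2 - chebTz m.+1.
  rewrite chebTz_rec; congr (_ - chebTz _); lia.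
have r2 : chebTz m.+2 = 2%:P * 'X * chebTz m.+1 - chebTz m.
  have -> : m.+2 = m.+1%:Z + 1 :> int by lia.
  rewrite chebTz_rec; congr (_ - chebTz _); lia.
have r3 : chebTz m.+1 = 2%:P * 'X * chebTz m - chebTz (m%:Z - 1).
  have -> : m.+1 = m%:Z + 1 :> int by lia.
  by rewrite chebTz_rec.
have -> : m.+2%:Z - 1 = m.+1 by lia.
have -> : m.+1%:Z - 1 = m by lia.
have -> : m.+1%:Z + 1 = m.+2 by lia.
have -> : m%:Z + 1 = m.+1 by lia.
have -> : chebT F m.+1 = chebTz m.+1 by [].
have r3' : chebTz (m%:Z - 1) = 2%:P * 'X * chebTz m - chebTz m.+1
  by rewrite r3; ring.
rewrite r1 r2 r3' -!natr1; ring.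
Qed.

(** The product formula for 2 sin (k t) sin (m t). Both sides satisfy the
Chebyshev recurrence in k, so only k = 0 and k = 1 need an argument. It is
what makes the Pearson equation a two-term relation between moments. *)
Lemma chebUp_deriv_chebT k m :
  2%:P * (1 - 'X^2) * chebUp k * deriv (chebT F m) =
  m%:R%:P * (chebTz (m%:Z - k%:Z) - chebTz (m%:Z + k%:Z)).
Proof.
elim/nat_ind2: k => [||k IH0 IH1].
- have -> : m%:Z + 0%:Z = m by lia.
  by rewrite /=; ring.
- by rewrite /= mulr1 deriv_chebT_1.
rewrite chebUp_rec.
have -> : 2%:P * (1 - 'X^2) * (2%:P * 'X * chebUp k.+1 - chebUp k) * deriv
  (chebT F m) =
  2%:P * 'X * (2%:P * (1 - 'X^2) * chebUp k.+1 * deriv (chebT F m)) -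
  2%:P * (1 - 'X^2) * chebUp k * deriv (chebT F m) by ring.
rewrite IH0 IH1.
have -> : m%:Z + k.+2%:Z = (m%:Z + k.+1%:Z) + 1 by lia.
have -> : m%:Z - k.+2%:Z = (m%:Z - k.+1%:Z) - 1 by lia.
have -> : chebTz (m%:Z - k.+1%:Z - 1) =
  2%:P * 'X * chebTz (m%:Z - k.+1%:Z) - chebTz (m%:Z - k.+1%:Z + 1).
  by rewrite chebTz_rec; ring.
rewrite [chebTz (m%:Z + k.+1%:Z + 1)]chebTz_rec.
have -> : m%:Z + k.+1%:Z - 1 = m%:Z + k%:Z by lia.
have -> : m%:Z - k.+1%:Z + 1 = m%:Z - k%:Z by lia.
ring.
Qed.

Lemma two_poly_neq0 : (2%:P : {poly F}) != 0.
Proof. by rewrite polyC_eq0 pnatr_eq0. Qed.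

Lemma one_sub_X2_neq0 : (1 - 'X^2 : {poly F}) != 0.
Proof.
apply/eqP => /(congr1 (horner^~ 0)); rewrite !hornerE expr0n /= subr0 => /eqP.
by rewrite oner_eq0.
Qed.

Lemma chebT_sub k : 2%:P * (1 - 'X^2) * chebUp k =
  chebTz (k%:Z - 1) - chebTz (k%:Z + 1).
Proof.
have := chebUp_deriv_chebT k 1; rewrite /= derivX !mulr1 mul1r => ->.
congr (_ - chebTz _); last lia.
by rewrite -chebTzN; congr chebTz; lia.
Qed.

Lemma deriv_chebT m : deriv (chebT F m) = m%:R *: chebUp m.
Proof.
have /eqP := deriv_chebT_1 m; rewrite -chebT_sub => /eqP h.
have nz : 2%:P * (1 - 'X^2) != 0 :> {poly F}.
  by rewrite mulf_neq0 // ?two_poly_neq0 ?one_sub_X2_neq0.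
by apply: (mulfI nz); rewrite h -mul_polyC; ring.
Qed.

Lemma chebUp_sub k : chebUp k.+2 - chebUp k = 2%:P * chebT F k.+1.
Proof.
have nz : 2%:P * (1 - 'X^2) != 0 :> {poly F}.
  by rewrite mulf_neq0 // ?two_poly_neq0 ?one_sub_X2_neq0.
apply: (mulfI nz); rewrite mulrBr !chebT_sub.
have -> : k.+2%:Z - 1 = k.+1 by lia.
have -> : k%:Z + 1 = k.+1 by lia.
rewrite [chebTz (k.+2%:Z + 1)]chebTz_rec.
have -> : k.+2%:Z - 1 = k.+1 by lia.
have -> : chebTz k.+2 = 2%:P * 'X * chebTz k.+1 - chebTz k by [].
have -> : chebTz (k%:Z - 1) = 2%:P * 'X * chebTz k - chebTz k.+1.
  have -> : k.+1%:Z = k%:Z + 1 by lia.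
  by rewrite chebTz_rec; ring.
rewrite -[chebT F k.+1]/(chebTz k.+1) ; ring.
Qed.

Lemma deriv_Phi k : deriv ((1 - 'X^2) * chebUp k.+1) =
  - ('X * chebUp k.+1) - k.+1%:R *: chebT F k.+1.
Proof.
apply: (mulfI two_poly_neq0).
have -> : 2%:P * deriv ((1 - 'X^2) * chebUp k.+1) =
   deriv (2%:P * (1 - 'X^2) * chebUp k.+1).
  by rewrite -mulrA derivM derivC mul0r add0r.
rewrite chebT_sub.
have -> : k.+1%:Z - 1 = k by lia.
have -> : k.+1%:Z + 1 = k.+2 by lia.
rewrite derivB !deriv_chebT.
rewrite mulrBr -scalerAr -chebUp_sub mulrN mulrA.
have -> : 2%:P * 'X * chebUp k.+1 = chebUp k.+2 + chebUp k
  by rewrite chebUp_rec; ring.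
rewrite -!mul_polyC -!natr1 !rmorphD /= rmorph1; ring.
Qed.

(** cos^2 + sin^2 = 1 at the angle k t; the Bezout relation behind the class. *)
Lemma cheb_pell k : chebT F k ^+ 2 + (1 - 'X^2) * chebUp k ^+ 2 = 1.
Proof.
case: k => [|k]; first by rewrite /= expr0n mulr0 addr0 expr1n.
have h1 := chebT_mul k.+1 k.+1; have h2 := chebUp_deriv_chebT k.+1 k.+1.
rewrite deriv_chebT in h2.
have h3 : 2%:P * (1 - 'X^2) * chebUp k.+1 ^+ 2 =
  chebTz (k.+1%:Z - k.+1%:Z) - chebTz (k.+1%:Z + k.+1%:Z).
  have nz : (k.+1%:R%:P : {poly F}) != 0 by rewrite polyC_eq0 pnatr_eq0.
  by apply: (mulfI nz); rewrite -h2 -mul_polyC; ring.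
apply: (mulfI two_poly_neq0).
have -> : 2%:P * (chebT F k.+1 ^+ 2 + (1 - 'X^2) * chebUp k.+1 ^+ 2) =
  2%:P * chebT F k.+1 * chebTz k.+1 + 2%:P * (1 - 'X^2) * chebUp k.+1 ^+ 2.
  by rewrite /chebTz /=; ring.
rewrite h1 h3 subrr /chebTz /=; ring.
Qed.

Lemma size_2X : size (2%:P * 'X : {poly F}) = 2%N.
Proof. by rewrite mul_polyC size_scale ?size_polyX // pnatr_eq0. Qed.

Lemma size_rec (f g : {poly F}) m : size f = m.+2 -> size g = m.+1 ->
  size (2%:P * 'X * f - g) = m.+3.
Proof.
move=> sf sg.
have sX : size (2%:P * 'X * f) = m.+3.
  by rewrite -mulrA mul_polyC size_scale ?pnatr_eq0 // mulrC size_mulX ?sf //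
    -size_poly_gt0 sf.
by rewrite size_polyDl ?sX // size_polyN sg.
Qed.

Lemma size_chebT m : size (chebT F m) = m.+1.
Proof.
elim/nat_ind2: m => [||m IH0 IH1]; rewrite /= ?size_poly1 ?size_polyX //.
exact: (size_rec IH1 IH0).
Qed.

Lemma size_chebU m : size (chebU F m) = m.+1.
Proof.
elim/nat_ind2: m => [||m IH0 IH1]; rewrite ?size_poly1 ?size_2X //.
exact: (size_rec IH1 IH0).
Qed.

End Chebyshev.

(** * Linear functionals on polynomials *)

Section Functionals.
Variable F : fieldType.
Implicit Types (p c : nat -> {poly F}) (u v : {scalar {poly F}})
  (q f g : {poly F}).

(** Peeling off leading terms along a basis with one element in each degree.
It is stated for a predicate closed under linear combinations, so that it
applies both to the vanishing and to the equality of linear maps that have not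
been packaged. *)
Lemma graded_ind p (P : {poly F} -> Prop) n :
  (forall i, size (p i) = i.+1) -> P 0 ->
  (forall a f g, P f -> P g -> P (a *: f + g)) ->
  (forall i, (i < n)%N -> P (p i)) ->
  forall q, (size q <= n)%N -> P q.
Proof.
move=> sp P0 Plin; elim: n => [|n IH] Pp q.
  by rewrite size_poly_leq0 => /eqP ->.
move=> sq; set a := q`_n / (p n)`_n.
have pn0 : (p n)`_n != 0.
  have : lead_coef (p n) != 0 by rewrite lead_coef_eq0 -size_poly_gt0 sp.
  by rewrite /lead_coef sp.
have -> : q = a *: p n + (q - a *: p n) by ring.
apply: Plin; first exact: Pp.
apply: IH => [i hi|]; first by apply: Pp; apply: ltnW.
apply/leq_sizeP => j; rewrite leq_eqVlt => /orP[/eqP <-|hj].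
  by rewrite coefB coefZ /a divfK // subrr.
rewrite coefB coefZ !nth_default ?mulr0 ?subrr //.
  by rewrite sp.
exact: leq_trans sq hj.
Qed.

Lemma graded_all p (P : {poly F} -> Prop) :
  (forall i, size (p i) = i.+1) -> P 0 ->
  (forall a f g, P f -> P g -> P (a *: f + g)) ->
  (forall i, P (p i)) -> forall q, P q.
Proof.
by move=> sp P0 Plin Pp q; apply: (graded_ind (n := size q) sp P0 Plin).
Qed.

(** The functional with moments [mu]. Multiplication of a formal series by a
polynomial has the same shape, with the shifted coefficients as moments. *)
Definition moment_sum (mu : nat -> F) (q : {poly F}) : F :=
  \sum_(i < size q) q`_i * mu i.

Lemma moment_sum_wide mu q n : (size q <= n)%N ->
  moment_sum mu q = \sum_(i < n) q`_i * mu i.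
Proof.
move=> sq; rewrite /moment_sum (big_ord_widen _ (fun i => q`_i * mu i) sq).
rewrite big_mkcond; apply: eq_bigr => i _; case: ltnP => // hi.
by rewrite nth_default // mul0r.
Qed.

Lemma moment_sum_is_scalar mu : scalar (moment_sum mu).
Proof.
move=> a f g; set n := maxn (size f) (size g).
have h : (size (a *: f + g)%R <= n)%N.
  rewrite (leq_trans (size_polyD _ _)) // geq_max leq_maxr andbT.
  by rewrite (leq_trans (size_scale_leq _ _)) // leq_maxl.
rewrite (moment_sum_wide _ h) (moment_sum_wide _ (leq_maxl _ (size g))).
rewrite (moment_sum_wide _ (leq_maxr (size f) _)).
rewrite mulr_sumr -big_split; apply: eq_bigr => i _ /=.
by rewrite coefD coefZ mulrDl mulrA.
Qed.

HB.instance Definition _ mu := GRing.isLinear.Build F {poly F} F *%R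
  (moment_sum mu) (moment_sum_is_scalar mu).

(** The moments solve a triangular system: the value at p_n fixes the n-th
moment once the previous ones are known, as p_n has a nonzero leading
coefficient. *)
Lemma functional_of_values p (a : nat -> F) :
  (forall i, size (p i) = i.+1) ->
  exists u, forall n, u (p n) = a n.
Proof.
move=> sp.
pose fix ml n : seq F := if n is m.+1 then
  rcons (ml m) ((a m - \sum_(i < m) (p m)`_i * (ml m)`_i) / (p m)`_m)
  else [::].
have sml n : size (ml n) = n by elim: n => //= n IH; rewrite size_rcons IH.
pose mu n := (ml n.+1)`_n.
have mlE n i : (i < n)%N -> (ml n)`_i = mu i.
  elim: n => // n IH; rewrite ltnS leq_eqVlt => /orP[/eqP -> //|hi].
  by rewrite -IH //= nth_rcons sml hi.
exists (moment_sum mu) => n.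
rewrite /= (@moment_sum_wide _ _ n.+1) ?sp // big_ord_recr /=.
have -> : mu n = (a n - \sum_(i < n) (p n)`_i * mu i) / (p n)`_n.
  rewrite {1}/mu /= nth_rcons sml ltnn eqxx; congr ((_ - _) / _).
  by apply: eq_bigr => i _; rewrite mlE.
have pn0 : (p n)`_n != 0.
  have : lead_coef (p n) != 0 by rewrite lead_coef_eq0 -size_poly_gt0 sp.
  by rewrite /lead_coef sp.
by rewrite mulrCA divff // mulr1 addrC subrK.
Qed.

(** Half of Favard's theorem: once the functional kills all c_n with n > 0,
the recurrence alone yields v (c_m c_n) = 0 for m < n by moving X from one
factor to the other, and the norms are products of the coefficients of the
recurrence. *)
Lemma favard c v (al ga : nat -> F) :
  (forall n, size (c n) = n.+1) ->
  'X * c 0%N = al 0%N *: c 1%N ->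
  (forall n, 'X * c n.+1 = al n.+1 *: c n.+2 + ga n.+1 *: c n) ->
  (forall n, ga n.+1 != 0) ->
  c 0%N = 1 -> v 1 != 0 -> (forall n, v (c n.+1) = 0) ->
  is_OPS v c.
Proof.
move=> sc h0 hS ga0 c0 v1 vc.
have al0 n : al n != 0.
  apply/eqP => an0.
  have sX : size ('X * c n) = n.+2.
    by rewrite mulrC size_mulX ?sc // -size_poly_gt0 sc.
  case: n an0 sX => [|n] an0.
    by rewrite h0 an0 scale0r size_poly0.
  rewrite hS an0 scale0r add0r => sX.
  have := size_scale_leq (ga n.+1) (c n); rewrite sX sc; lia.
have orth m : forall n, (m < n)%N -> v (c m * c n) = 0.
  elim/nat_ind2: m => [||m IH0 IH1] n.
  - by case: n => // n _; rewrite c0 mul1r.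
  - case: n => [|[|n]] // _; apply: (mulfI (al0 0%N)); rewrite mulr0.
    rewrite -linearZ /= scalerAl -h0 c0 mulr1 hS linearD !linearZ /= !vc.
    by rewrite !mulr0 addr0.
  - case: n => [|n] // hn; apply: (mulfI (al0 m.+1)); rewrite mulr0.
    have -> : al m.+1 * v (c m.+2 * c n.+1) =
        v (c m.+1 * ('X * c n.+1)) - ga m.+1 * v (c m * c n.+1).
      rewrite mulrCA mulrA hS mulrDl linearD -!scalerAl !linearZ /=; ring.
    rewrite IH0; last lia.
    rewrite hS mulrDr linearD -!scalerAr !linearZ /= !IH1; try lia.
    ring.
split=> // [n m|n].
  case: (ltngtP n m) => // h _; first exact: orth.
  by rewrite mulrC orth.
elim: n => [|n IH]; first by rewrite c0 expr1n.
have : al n * v (c n.+1 ^+ 2) = ga n.+1 * v (c n ^+ 2).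
  have -> : ga n.+1 * v (c n ^+ 2) = v (c n * ('X * c n.+1)).
    rewrite hS mulrDr linearD -!scalerAr !linearZ /= (orth n n.+2) //.
    by rewrite mulr0 add0r.
  rewrite mulrCA [X in _ = v X]mulrA expr2 -linearZ /= scalerAl.
  case: n {IH} => [|n]; first by rewrite -h0.
  have -> : al n.+1 *: c n.+2 = 'X * c n.+1 - ga n.+1 *: c n.
    by rewrite hS addrK.
  by rewrite mulrBl linearB -scalerAl linearZ /= orth // mulr0 subr0.
move=> e; have : al n * v (c n.+1 ^+ 2) != 0 by rewrite e mulf_neq0.
by rewrite mulf_eq0 negb_or => /andP[].
Qed.

(** A nonzero f of degree n would satisfy u (f c_n) =
   a u (c_n^2) with a != 0. *)
Lemma regular_inj u f : regular u -> (forall g, u (f * g) = 0) -> f = 0.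
Proof.
case=> c [sc orth nz] uf; apply/eqP; apply: contraT => f0.
have [n sf] : exists n, size f = n.+1.
  by exists (size f).-1; rewrite prednK // size_poly_gt0.
pose a := f`_n / (c n)`_n.
have fn0 : f`_n != 0 by rewrite -lead_coef_eq0 /lead_coef sf in f0.
have cn0 : (c n)`_n != 0.
  have : lead_coef (c n) != 0 by rewrite lead_coef_eq0 -size_poly_gt0 sc.
  by rewrite /lead_coef sc.
have low q : (size q <= n)%N -> u (q * c n) = 0.
  move: q; apply: (graded_ind sc) => [|b g h hg hh|i hi].
  - by rewrite mul0r linear0.
  - by rewrite mulrDl linearD -scalerAl linearZ /= hg hh mulr0 addr0.
  - by apply: orth => e; rewrite e ltnn in hi.
have : u (f * c n) = a * u (c n ^+ 2).
  have {1}-> : f = a *: c n + (f - a *: c n) by ring.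
  rewrite mulrDl linearD -scalerAl linearZ /= low ?addr0 //.
  apply/leq_sizeP => j; rewrite leq_eqVlt => /orP[/eqP <-|hj].
    by rewrite coefB coefZ /a divfK // subrr.
  by rewrite coefB coefZ !nth_default ?mulr0 ?subrr // ?sc ?sf.
by rewrite uf => /eqP; rewrite eq_sym !mulf_eq0 invr_eq0 (negbTE fn0) (negbTE
  cn0) (negbTE (nz n)).
Qed.

End Functionals.

(** * The sieved recurrence and its orthogonality functional *)

Section SievedRecurrence.
Variable F : numFieldType.
Implicit Types (la : F) (k m n : nat).

(** The recurrence that the limit s -> 1 produces: Chebyshev's, except at the
indices divisible by k, where the parameter of the ultraspherical family
enters. *)
Fixpoint sieved_poly la k n : {poly F} :=
  match n with
  | 0 => 1
  | (m.+1 as n').+1 =>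
    if (k %| n')%N then
      (2 * la + (n' %/ k)%:R)^-1 *:
        ((2 * (la + (n' %/ k)%:R)) *: ('X * sieved_poly la k n')
         - (n' %/ k)%:R *: sieved_poly la k m)
    else 2%:P * 'X * sieved_poly la k n' - sieved_poly la k m
  | 1 => 'X
  end.

Lemma sieved_polyS la k n : sieved_poly la k n.+2 =
    if (k %| n.+1)%N then
      (2 * la + (n.+1 %/ k)%:R)^-1 *:
        ((2 * (la + (n.+1 %/ k)%:R)) *: ('X * sieved_poly la k n.+1)
         - (n.+1 %/ k)%:R *: sieved_poly la k n)
    else 2%:P * 'X * sieved_poly la k n.+1 - sieved_poly la k n.
Proof. by []. Qed.

Variables (la : F) (k : nat).
Hypothesis k0 : (0 < k)%N.
Hypothesis hla : forall n, 2 * la + n.+1%:R != 0.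

Let la_neq0 n : la + n.+1%:R != 0.
Proof.
have := hla (n.+1).*2.-1; rewrite prednK ?double_gt0 // -mul2n natrM -mulrDr.
by rewrite mulf_eq0 negb_or => /andP[].
Qed.

(** The coefficients of c_(n+1) and c_(n-1) in X c_n. *)
Definition sieved_up n : F :=
  if n is 0 then 1 else
  if (k %| n)%N then (2 * la + (n %/ k)%:R) / (2 * (la +
    (n %/ k)%:R)) else 2^-1.
Definition sieved_down n : F :=
  if (k %| n)%N then (n %/ k)%:R / (2 * (la + (n %/ k)%:R)) else 2^-1.

Lemma divnk_pos n : (k %| n.+1)%N -> exists m, (n.+1 %/ k)%N = m.+1.
Proof.
move=> d; exists (n.+1 %/ k).-1; rewrite prednK // divn_gt0 //.
exact: dvdn_leq.
Qed.

Lemma sieved_three_term n : 'X * sieved_poly la k n.+1 =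
  sieved_up n.+1 *: sieved_poly la k n.+2 +
    sieved_down n.+1 *: sieved_poly la k n.
Proof.
have two0 : (2 : F) != 0 by rewrite pnatr_eq0.
rewrite sieved_polyS /sieved_up /sieved_down; case: ifP => [d|_].
  have [m ->] := divnk_pos d.
  have h1 := hla m; have h2 := la_neq0 m.
  rewrite scalerA mulrAC divff // mul1r scalerBr scalerA mulVf ?mulf_neq0 //.
  rewrite scalerA scale1r [X in _ - X *: _]mulrC; ring.
rewrite scalerBr subrK -mulrA mul_polyC scalerA mulVf // scale1r //.
Qed.

Lemma sieved_down_neq0 n : sieved_down n.+1 != 0.
Proof.
rewrite /sieved_down; case: ifP => [d|_]; last by rewrite invr_eq0 pnatr_eq0.
have [m ->] := divnk_pos d.
by rewrite mulf_neq0 ?invr_eq0 ?mulf_neq0 ?pnatr_eq0 // la_neq0.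
Qed.

Lemma size_sieved_poly n : size (sieved_poly la k n) = n.+1.
Proof.
elim/nat_ind2: n => [||n IH0 IH1]; rewrite ?size_poly1 ?size_polyX //.
rewrite sieved_polyS; case: ifP => [d|_]; last exact: size_rec.
have [m ->] := divnk_pos d.
rewrite size_scale ?invr_eq0 ?hla //.
have sX : size (('X * sieved_poly la k n.+1)) = n.+3.
  by rewrite mulrC size_mulX ?IH1 // -size_poly_gt0 IH1.
rewrite size_polyDl size_scale ?sX // ?mulf_neq0 ?pnatr_eq0 ?la_neq0 //.
by rewrite size_polyN (leq_ltn_trans (size_scale_leq _ _)) // IH0.
Qed.

(** (la + 1)_n / n!, the coefficient of w^n in (1 - w)^(- la - 1). *)
Definition rising n : F := \prod_(i < n) ((la + i.+1%:R) / i.+1%:R).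

(** The previous coefficient, so that [rising n - rising_pred n] is (la)_n /
n!. This form keeps [la = 0] and the boundary terms of the sums uniform. *)
Definition rising_pred n : F := if n is m.+1 then rising m else 0.

(** n! / (2 la + 1)_n. *)
Definition block_scale n : F := \prod_(i < n) (i.+1%:R / (2 * la + i.+1%:R)).

Lemma rising_ratio n : n%:R * rising n = (la + n%:R) * rising_pred n.
Proof.
case: n => [|n]; first by rewrite mul0r mulr0.
rewrite /rising_pred {1}/rising big_ord_recr /= -/(rising n).
have h : n.+1%:R != 0 :> F by rewrite pnatr_eq0.
by field; rewrite addrC natr1.
Qed.

Lemma block_scale_rec n : (2 * la + n.+1%:R) * block_scale n.+1 =
  n.+1%:R * block_scale n.
Proof.
rewrite /block_scale big_ord_recr /= -/(block_scale n); set d := 2 * la + _.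
by rewrite mulrCA [d * _]mulrC divfK ?hla // mulrC.
Qed.

(** Sums over i + j = m. All the identities for the sieved polynomials reduce
to exchanging i and j, under which T_(k (j - i)) is invariant. *)
Section AntidiagonalSums.
Variable V : lmodType F.
Definition sum_antidiag m (X : nat -> nat -> V) : V :=
  \sum_(i < m.+1) X i (m - i)%N.

Lemma eq_sum_antidiag m X Y : (forall i j, (i + j)%N = m -> X i j = Y i j) ->
  sum_antidiag m X = sum_antidiag m Y.
Proof. by move=> h; apply: eq_bigr => i _; apply: h; have := ltn_ord i;
  lia. Qed.

Lemma sum_antidiag_swap m X : sum_antidiag m X =
  sum_antidiag m (fun i j => X j i).
Proof.
rewrite /sum_antidiag (reindex_inj rev_ord_inj); apply: eq_bigr => i _ /=.
by rewrite subSS; congr X; have := ltn_ord i; lia.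
Qed.

Lemma sum_antidiagD m X Y : sum_antidiag m (fun i j => X i j + Y i j) =
  sum_antidiag m X + sum_antidiag m Y.
Proof. by rewrite /sum_antidiag big_split. Qed.

Lemma sum_antidiagZ m a X : sum_antidiag m (fun i j => a *: X i j) =
  a *: sum_antidiag m X.
Proof. by rewrite /sum_antidiag scaler_sumr. Qed.

Lemma sum_antidiag_antisym m X : (forall i j, (i + j)%N = m -> X j i =
  - X i j) ->
  sum_antidiag m X = 0.
Proof.
move=> h; have e : 2%:R *: sum_antidiag m X = 0.
  rewrite scaler_nat mulr2n {2}sum_antidiag_swap -sum_antidiagD.
  rewrite /sum_antidiag big1 // => i _; have hi := ltn_ord i.
  by rewrite (h i (m - i)%N) ?subrr //; lia.
by move/eqP: e; rewrite scaler_eq0 pnatr_eq0 => /eqP.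
Qed.

Lemma sum_antidiag_recr m X : (forall i, X i 0%N = 0) ->
  sum_antidiag m.+1 X = sum_antidiag m (fun i j => X i j.+1).
Proof.
move=> h; rewrite /sum_antidiag big_ord_recr /= subnn h addr0.
by apply: eq_bigr => i _; congr X; have := ltn_ord i; lia.
Qed.
End AntidiagonalSums.

Definition gap (i j : nat) : int := j%:Z - i%:Z.

(** Up to a scalar, the expansion of c_(m k + r) in the Chebyshev basis for 0
<= r <= k; see [sieved_block]. *)
Definition block m (r : int) : {poly F} :=
  sum_antidiag m (fun i j => ((rising i - rising_pred i) * rising j)
    *: chebTz F (k%:Z * gap i j + r)).

(** The combination [block (m - 1)] re-indexed so that r counts from the
multiple m k of k at which two blocks meet; see [block_shift]. *)
Definition edge m (r : int) : {poly F} :=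
  sum_antidiag m (fun i j => ((rising i - rising_pred i) * rising_pred j)
    *: chebTz F (k%:Z * gap i j + r)).

Lemma block_rec m r : block m (r + 1) = 2%:P * 'X * block m r - block m (r - 1).
Proof.
rewrite /block /sum_antidiag mulr_sumr -sumrB; apply: eq_bigr => i _.
by rewrite addrA chebTz_rec -scalerAr scalerBr addrA.
Qed.

Lemma edge_rec m r : edge m (r + 1) = 2%:P * 'X * edge m r - edge m (r - 1).
Proof.
rewrite /edge /sum_antidiag mulr_sumr -sumrB; apply: eq_bigr => i _.
by rewrite addrA chebTz_rec -scalerAr scalerBr addrA.
Qed.

Lemma block_shift m r : block m (k%:Z + r) = edge m.+1 r.
Proof.
rewrite /edge sum_antidiag_recr; last by move=> i; rewrite mulr0 scale0r.
apply: eq_sum_antidiag => i j _; congr (_ *: chebTz F _); rewrite /gap; lia.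
Qed.

(** The sieved recurrence at the index m k, read on coefficients. Exchanging i
and j turns r into - r, which is where the term with the opposite sign comes
from; what is left is [rising_ratio]. *)
Lemma block_edge m r :
  m%:R *: block m r = (la + m%:R) *: edge m r + la *: edge m (- r).
Proof.
rewrite /edge [X in la *: X]sum_antidiag_swap -!sum_antidiagZ -sum_antidiagD.
apply: eq_sum_antidiag => i j <-.
have -> : chebTz F (k%:Z * gap j i - r) = chebTz F (k%:Z * gap i j + r).
  by rewrite -chebTzN; congr chebTz; rewrite /gap; lia.
rewrite !scalerA -scalerDl; congr (_ *: _).
have hi := rising_ratio i; have hj := rising_ratio j.
have e : i%:R * (rising i - rising_pred i) = la * rising_pred i
  by rewrite mulrBr hi; ring.
have -> : (i + j)%:R * ((rising i - rising_pred i) * rising j) =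
   i%:R * (rising i - rising_pred i) * rising j +
     (rising i - rising_pred i) * (j%:R * rising j).
  by rewrite natrD; ring.
rewrite hj e natrD.
have -> : (la + (i%:R + j%:R)) * ((rising i - rising_pred i) * rising_pred j) =
  (la + j%:R) * ((rising i - rising_pred i) * rising_pred j) +
    i%:R * (rising i - rising_pred i) * rising_pred j by ring.
rewrite e; ring.
Qed.

Lemma sieved_block_step m :
  sieved_poly la k (m * k) = block_scale m *: block m 0 ->
  sieved_poly la k (m * k).+1 = block_scale m *: block m 1 ->
  forall r, (r <= k)%N -> sieved_poly la k (m * k + r) =
    block_scale m *: block m r%:Z.
Proof.
move=> H0 H1; elim/nat_ind2 => [||r IH0 IH1] hr.
- by rewrite addn0.
- by rewrite addn1.
have -> : (m * k + r.+2 = (m * k + r).+2)%N by lia.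
rewrite sieved_polyS ifF; last first.
  by apply/negP; rewrite -addnS dvdn_addr ?dvdn_mull // => /dvdn_leq; lia.
have -> : ((m * k + r).+1 = m * k + r.+1)%N by lia.
rewrite IH0 ?IH1; try lia.
have -> : r.+2%:Z = r.+1%:Z + 1 by lia.
rewrite block_rec scalerBr scalerAr; congr (_ - _ *: block _ _); lia.
Qed.

(** Inside a block the recurrence is Chebyshev's, which every T_(l + r)
satisfies in r, so two initial values at the multiple m k determine it;
[block_edge] shows that the recurrence at m k carries one block to the next. *)
Lemma sieved_block m r : (r <= k)%N -> sieved_poly la k (m * k + r) =
  block_scale m *: block m r%:Z.
Proof.
move: r; suff [H0 H1] : sieved_poly la k (m * k) = block_scale m *: block m 0 /\
         sieved_poly la k (m * k).+1 = block_scale m *: block m 1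
           by exact: sieved_block_step.
elim: m => [|m [IH0 IH1]].
  rewrite mul0n /block_scale big_ord0 !scale1r /block /sum_antidiag
    !big_ord_recr !big_ord0 /=.
  by rewrite /rising !big_ord0 subr0 mulr1 !scale1r /gap subrr mulr0 !add0r.
have IHr := sieved_block_step IH0 IH1.
have e0 : sieved_poly la k (m.+1 * k) = block_scale m *: edge m.+1 0.
  have -> : (m.+1 * k = m * k + k)%N by lia.
  by rewrite IHr // -block_shift addr0.
have e1 : sieved_poly la k (m.+1 * k).-1 = block_scale m *: edge m.+1 (-1).
  have -> : ((m.+1 * k).-1 = m * k + k.-1)%N by lia.
  rewrite IHr; last lia.
  by rewrite -block_shift; congr (_ *: block _ _); lia.
have hm := hla m.
have gNE : block_scale m.+1 = m.+1%:R * block_scale m / (2 * la + m.+1%:R).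
  by rewrite -block_scale_rec mulrAC divff // mul1r.
have gb r : block_scale m.+1 *: block m.+1 r =
  (block_scale m / (2 * la + m.+1%:R)) *:
    ((la + m.+1%:R) *: edge m.+1 r + la *: edge m.+1 (- r)).
  by rewrite gNE -block_edge scalerA; congr (_ *: _); ring.
split.
  rewrite gb oppr0 -scalerDl scalerA e0; congr (_ *: _).
  have -> : la + m.+1%:R + la = 2 * la + m.+1%:R by ring.
  by rewrite divfK.
have mk0 : (0 < m.+1 * k)%N by rewrite muln_gt0.
have -> : ((m.+1 * k).+1 = (m.+1 * k).-1.+2)%N by rewrite prednK.
rewrite sieved_polyS prednK // dvdn_mull // mulnK // e0 e1 gb.
have -> : edge m.+1 1 = 2%:P * 'X * edge m.+1 0 - edge m.+1 (-1).
  by rewrite -{1}[1]add0r edge_rec.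
rewrite -!mul_polyC; ring.
Qed.

(** For la > 0, normalized Fourier coefficients of |sin t|^(2 la): the
integral of cos (2 m t) |sin t|^(2 la) divided by that of |sin t|^(2 la). *)
Definition even_moment m : F := \prod_(i < m) ((i%:R - la) / (i.+1%:R + la)).

(** The value at T_n of the functional with weight |sin (k t)|^(2 la) dt, x =
cos t, when la > 0. The weight is invariant under a shift of t by pi / k,
hence only multiples of 2 k contribute. *)
Definition cheb_moment n : F :=
  if (2 * k %| n)%N then even_moment (n %/ (2 * k)) else 0.

(** Integration by parts against |sin (k t)|^(2 la), that is, the Pearson
equation tested at T_n. *)
Lemma cheb_moment_rec n :
  (n%:R - k%:R * (2 * la + 1)) * cheb_moment `|n%:Z - k%:Z| =
  (n%:R + k%:R * (2 * la + 1)) * cheb_moment (n + k).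
Proof.
case d : (2 * k %| n + k)%N; last first.
  rewrite /cheb_moment d ifF ?mulr0 //; apply/negP => d'.
  move/negP: d; apply.
  have : (2 * k %| `|n%:Z - k%:Z| + 2 * k)%N by rewrite dvdn_addl.
  case: (leqP k n) => h.
    by have -> : (`|n%:Z - k%:Z| + 2 * k = n + k)%N by lia.
  move: d'; have -> : `|n%:Z - k%:Z|%N = (k - n)%N by lia.
  case/dvdnP => q; case: q => [|q] hq; first lia. nia.
case/dvdnP: (d) => q; case: q => [|q] hq; first lia.
have k20 : (0 < 2 * k)%N by lia.
have -> : n = (q.*2.+1 * k)%N by rewrite -mul2n; nia.
have -> : `|(q.*2.+1 * k)%:Z - k%:Z|%N = (q * (2 * k))%N by rewrite -mul2n; lia.
have -> : (q.*2.+1 * k + k = q.+1 * (2 * k))%N by rewrite -mul2n; lia.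
have mT x : cheb_moment (x * (2 * k)) = even_moment x.
  by rewrite /cheb_moment dvdn_mull // mulnK.
rewrite !mT /even_moment big_ord_recr /= -/(even_moment q).
have h : q.+1%:R + la != 0 by rewrite addrC la_neq0.
rewrite natrM -natr1 -mul2n natrM; rewrite -natr1 in h *.
by field.
Qed.

Variable v : {scalar {poly F}}.
Hypothesis vT : forall n, v (chebT F n) = cheb_moment n.

Lemma v_chebTz n : v (chebTz F n) = cheb_moment `|n|%N.
Proof. exact: vT. Qed.

Lemma v_chebTz_rec (l : int) :
  (l%:~R - (2 * la + 1)) * v (chebTz F (k%:Z * (l - 1))) =
  (l%:~R + (2 * la + 1)) * v (chebTz F (k%:Z * (l + 1))).
Proof.
have kz : (k%:R : F) != 0 by rewrite pnatr_eq0 -lt0n.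
have H (j : nat) : (j%:~R - (2 * la + 1)) * v (chebTz F (k%:Z * (j%:Z - 1))) =
  (j%:~R + (2 * la + 1)) * v (chebTz F (k%:Z * (j%:Z + 1))).
  apply: (mulfI kz); have := cheb_moment_rec (k * j).
  rewrite !v_chebTz.
  have -> : absz (k%:Z * (j%:Z - 1)) = `|(k * j)%:Z - k%:Z|%N by lia.
  have -> : absz (k%:Z * (j%:Z + 1)) = (k * j + k)%N by lia.
rewrite natrM => h; rewrite -!pmulrn ?absz_nat [LHS]mulrA [RHS]mulrA [in
  RHS]mulrDr [in LHS]mulrBr; exact: h.
case: l => j; first exact: H.
have := H j.+1.
rewrite NegzE -[chebTz F (k%:Z * (- _ - 1))]chebTzN -[chebTz F (k%:Z * (- _ +
  1))]chebTzN.
have -> : - (k%:Z * (- j.+1%:Z - 1)) = k%:Z * (j.+1%:Z + 1) by lia.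
have -> : - (k%:Z * (- j.+1%:Z + 1)) = k%:Z * (j.+1%:Z - 1) by lia.
rewrite mulrNz => h.
have -> : - j.+1%:~R - (2 * la + 1) = - (j.+1%:~R + (2 * la + 1)) by ring.
have -> : - j.+1%:~R + (2 * la + 1) = - (j.+1%:~R - (2 * la + 1)) by ring.
by rewrite !mulNr h.
Qed.

(** This is v (c_(m k)) = 0 for m > 0. After symmetrization the coefficient of
v (T_(k (j - i))) becomes [rising i * rising_pred j * (j - i + 2 la)]; one use
of the moment relation [v_chebTz_rec] makes the sum antisymmetric in i and j. *)
Lemma v_edge m : v (edge m.+1 0) = 0.
Proof.
have hm := hla m.
apply: (mulfI hm); rewrite mulr0.
pose t (i j : nat) := v (chebTz F (k%:Z * gap i j)).
have tC i j : t j i = t i j.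
  by rewrite /t -chebTzN; congr (v (chebTz F _)); rewrite /gap; lia.
have -> : v (edge m.+1 0) =
    sum_antidiag m.+1 (fun i j => (rising i - rising_pred i) * rising_pred j *
      t i j : F^o).
  rewrite /edge /sum_antidiag linear_sum; apply: eq_bigr => i _.
  by rewrite linearZ /= addr0.
rewrite -[_ * _]/(_ *: (_ : F^o)) -sum_antidiagZ.
(* The symmetrized coefficient: the terms (i, j) and (j, i) of the difference
   cancel. *)
pose Y (i j : nat) : F^o := rising i * rising_pred j * (j%:R - i%:R +
  2 * la) * t i j.
have -> : sum_antidiag m.+1 (fun i j => (2 * la + m.+1%:R) *:
     ((rising i - rising_pred i) * rising_pred j * t i j : F^o))
   = sum_antidiag m.+1 Y.
  apply/eqP; rewrite -subr_eq0 -[- _]scaleN1r -sum_antidiagZ -sum_antidiagD;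
    apply/eqP.
  apply: sum_antidiag_antisym => i j e; rewrite /Y tC -e.
  have hi := rising_ratio i; have hj := rising_ratio j.
  rewrite /GRing.scale /= natrD.
  apply/eqP; rewrite -subr_eq0 opprK; apply/eqP.
  transitivity (2 * t i j * ((i%:R * rising i) * rising_pred j +
    (j%:R * rising j) * rising_pred i
      - (i%:R + j%:R + 2 * la) * rising_pred i * rising_pred j)); first by ring.
  by rewrite hi hj; ring.
rewrite sum_antidiag_recr; last by move=> i; rewrite /Y mulr0 !mul0r.
have H : sum_antidiag m (fun i j => Y i j.+1) = 0; last by rewrite H.
apply: sum_antidiag_antisym => i j _.
change (rising j * rising i * (i.+1%:R - j%:R + 2 * la) * t j i.+1 =
        - (rising i * rising j * (j.+1%:R - i%:R + 2 * la) * t i j.+1)).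
(* The moment relation at l = j - i links the indices j - (i + 1) and (j +
   1) - i. *)
have := v_chebTz_rec (j%:Z - i%:Z).
have -> : v (chebTz F (k%:Z * (j%:Z - i%:Z - 1))) = t j i.+1.
  by rewrite /t -chebTzN; congr (v (chebTz F _)); rewrite /gap; lia.
have -> : v (chebTz F (k%:Z * (j%:Z - i%:Z + 1))) = t i j.+1.
  by rewrite /t; congr (v (chebTz F _)); rewrite /gap; lia.
rewrite rmorphB /= -!pmulrn => h.
rewrite -(natr1 i) -(natr1 j).
have -> : rising j * rising i * (i%:R + 1 - j%:R + 2 * la) * t j i.+1 =
  - (rising j * rising i * ((j%:R - i%:R - (2 * la + 1)) * t j i.+1)) by ring.
by rewrite h; ring.
Qed.

(** For n not divisible by k, no index in the expansion of c_n is a multiple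
of k, so every term vanishes; the remaining case is [v_edge]. *)
Lemma v_sieved_poly n : v (sieved_poly la k n.+1) = 0.
Proof.
rewrite (divn_eq n.+1 k); set r := (n.+1 %% k)%N; set m := (n.+1 %/ k)%N.
have hr : (r < k)%N by rewrite ltn_mod.
have hn : n.+1 = (m * k + r)%N by rewrite -divn_eq.
case: (posnP r) => r0.
  case: m hn => [|m] hn; first by lia.
  have -> : (m.+1 * k + r = m * k + k)%N by lia.
  by rewrite sieved_block // -[k%:Z]addr0 block_shift linearZ /= v_edge mulr0.
rewrite sieved_block; last exact: ltnW.
rewrite linearZ /= /block /sum_antidiag linear_sum big1 ?mulr0 // => i _.
rewrite linearZ /= v_chebTz /cheb_moment ifF ?mulr0 //; apply/negP => d.
have : (k%:Z %| k%:Z * gap i (m - i) + r%:Z)%Z.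
  rewrite /dvdz /=; apply: dvdn_trans d; exact: dvdn_mull.
rewrite rpredDl ?dvdz_mulr // => /dvdn_leq; rewrite /= => /(_ r0); lia.
Qed.

Lemma cheb_moment0 : cheb_moment 0 = 1.
Proof. by rewrite /cheb_moment dvdn0 div0n /even_moment big_ord0. Qed.

Lemma sieved_OPS : is_OPS v (sieved_poly la k).
Proof.
apply: (@favard _ _ _ sieved_up sieved_down) => //.
- exact: size_sieved_poly.
- by rewrite /= mulr1 scale1r.
- exact: sieved_three_term.
- exact: sieved_down_neq0.
- by have := vT 0; rewrite /= cheb_moment0 => ->; rewrite oner_neq0.
- exact: v_sieved_poly.
Qed.

End SievedRecurrence.

(** * Formal Stieltjes series *)

Section Series.
Variable F : fieldType.
Implicit Types (p q : {poly F}) (f g : fseries F) (m : int).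

Lemma fs_pmulE p f m : fs_pmul p f m =
  moment_sum (fun i : nat => f (m - i%:Z)) p.
Proof. by []. Qed.

Lemma fs_pmulZ a p f m : fs_pmul (a *: p) f m = a * fs_pmul p f m.
Proof. by rewrite !fs_pmulE linearZ. Qed.

Lemma fs_pmulD p q f m : fs_pmul (p + q) f m = fs_pmul p f m + fs_pmul q f m.
Proof. by rewrite !fs_pmulE linearD. Qed.

Lemma fs_pmulB p q f m : fs_pmul (p - q) f m = fs_pmul p f m - fs_pmul q f m.
Proof. by rewrite !fs_pmulE linearB. Qed.

Lemma fs_pmul0 f m : fs_pmul 0 f m = 0.
Proof. by rewrite fs_pmulE linear0. Qed.

Lemma fs_pmulC c f m : fs_pmul c%:P f m = c * f m.
Proof.
rewrite fs_pmulE (@moment_sum_wide _ _ _ 1) ?size_polyC ?leq_b1 //.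
by rewrite big_ord_recl big_ord0 coefC /= addr0 subr0.
Qed.

Lemma fs_pmulMX p f m : fs_pmul (p * 'X) f m = fs_pmul p f (m - 1).
Proof.
rewrite !fs_pmulE (@moment_sum_wide _ _ (p * 'X) (size p).+1); last first.
  have [->|p0] := eqVneq p 0; first by rewrite mul0r size_poly0.
  by rewrite size_mulX.
rewrite big_ord_recl coefMX /= mul0r add0r /moment_sum; apply: eq_bigr => i _.
rewrite coefMX /=; congr (_ * f _); rewrite /bump /=; lia.
Qed.

Lemma fs_pmulMXaddC p c f m :
  fs_pmul (p * 'X + c%:P) f m = fs_pmul p f (m - 1) + c * f m.
Proof. by rewrite fs_pmulD fs_pmulMX fs_pmulC. Qed.

Lemma fs_pmul_ext p f g : f =1 g -> fs_pmul p f =1 fs_pmul p g.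
Proof. by move=> h m; rewrite /fs_pmul; apply: eq_bigr => i _; rewrite h. Qed.

Lemma fs_pmul_add p f g m :
  fs_pmul p (fs_add f g) m = fs_pmul p f m + fs_pmul p g m.
Proof.
by rewrite /fs_pmul -big_split; apply: eq_bigr => i _; rewrite /= -mulrDr.
Qed.

Lemma fs_pmulA p q f m : fs_pmul (p * q) f m = fs_pmul p (fs_pmul q f) m.
Proof.
elim/poly_ind: p m => [|p c IH] m; first by rewrite mul0r !fs_pmul0.
rewrite fs_pmulMXaddC mulrDl fs_pmulD mulrAC fs_pmulMX IH.
by rewrite mul_polyC fs_pmulZ.
Qed.

Lemma fs_polyMX p m : fs_poly (p * 'X) m = fs_poly p (m - 1).
Proof.
case: m => [[|n]|n]; first by rewrite /= coefMX.
  have -> : n.+1%:Z - 1 = n by lia.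
  by rewrite /= coefMX.
by have -> : Negz n - 1 = Negz n.+1 by lia.
Qed.

Lemma fs_pmul_poly p q m : fs_pmul p (fs_poly q) m = fs_poly (p * q) m.
Proof.
elim/poly_ind: p m => [|p c IH] m.
  by rewrite mul0r fs_pmul0; case: m => n //=; rewrite coef0.
rewrite fs_pmulMXaddC mulrDl IH mulrAC.
have -> : fs_poly (p * q) (m - 1) = fs_poly (p * q * 'X) m by rewrite fs_polyMX.
by case: m => n /=; rewrite ?coefD ?mul_polyC ?coefZ // mulr0 addr0.
Qed.

Lemma fs_poly_inj p q : fs_poly p =1 fs_poly q -> p = q.
Proof. by move=> h; apply/polyP => i; apply: (h (Posz i)). Qed.

Lemma fs_deriv_pmul p f m : fs_deriv (fs_pmul p f) m =
  fs_pmul (deriv p) f m + fs_pmul p (fs_deriv f) m.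
Proof.
elim/poly_ind: p m => [|p c IH] m.
  by rewrite deriv0 /fs_deriv !fs_pmul0 mulr0 addr0.
rewrite derivMXaddC fs_pmulMXaddC fs_pmulD fs_pmulMX.
have := IH (m - 1); rewrite /fs_deriv !subrK fs_pmulMXaddC => h.
have -> : m + 1 - 1 = m by lia.
have -> : (m + 1)%:~R * (fs_pmul p f m + c * f (m + 1)) =
  m%:~R * fs_pmul p f m + fs_pmul p f m + c * ((m + 1)%:~R * f (m + 1)).
  by rewrite rmorphD /=; ring.
by rewrite h; ring.
Qed.

Variable u : {scalar {poly F}}.

(** The associated polynomial u_y ((p(z) - p(y)) / (z - y)): the coefficient
of z^j in the quotient is the polynomial in y obtained from p by dropping its
lowest j + 1 coefficients. *)
Definition assoc_poly p : {poly F} := \poly_(j < size p) u (drop_poly j.+1 p).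

Lemma coef_assoc_poly p j : (assoc_poly p)`_j = u (drop_poly j.+1 p).
Proof.
rewrite coef_poly; case: ltnP => // h.
by rewrite drop_poly_eq0 ?linear0 // ltnW.
Qed.

Lemma assoc_poly_is_linear : linear assoc_poly.
Proof.
move=> a p q; apply/polyP => j.
by rewrite coefD coefZ !coef_assoc_poly linearP /= linearP.
Qed.
HB.instance Definition _ := GRing.isLinear.Build F {poly F} {poly F} *:%R
  assoc_poly assoc_poly_is_linear.

Lemma assoc_polyMX p : assoc_poly (p * 'X) = assoc_poly p * 'X + (u p)%:P.
Proof.
apply/polyP => j; rewrite coefD coefMX coefC coef_assoc_poly.
have -> : drop_poly j.+1 (p * 'X) = drop_poly j p.
  by apply/polyP => i; rewrite !coef_drop_poly coefMX addnS.
case: j => [|j] /=; first by rewrite drop_poly0l add0r.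
by rewrite coef_assoc_poly addr0.
Qed.

Lemma assoc_polyC c : assoc_poly c%:P = 0.
Proof.
apply/polyP => j; rewrite coef_assoc_poly coef0 drop_poly_eq0 ?linear0 //.
by rewrite size_polyC; case: (c != 0).
Qed.

(** p(z) / (z - y) = p(y) / (z - y) + (p(z) - p(y)) / (z - y), to which u_y is
applied; recall the minus sign in the definition of the series. *)
Lemma stieltjes_pmul p m : fs_pmul p (stieltjes u) m =
  stieltjes (pmulf p u) m - fs_poly (assoc_poly p) m.
Proof.
elim/poly_ind: p m => [|p c IH] m.
  rewrite fs_pmul0 linear0 /stieltjes /pmulf.
  by case: m => n /=; rewrite ?coef0 ?mul0r ?linear0 ?subr0 ?oppr0.
rewrite fs_pmulMXaddC IH linearD /= assoc_polyMX assoc_polyC addr0.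
case: m => [[|n]|n].
- rewrite (_ : 0%:Z - 1 = Negz 0) //= coefD coefMX coefC /= /pmulf expr0 mulr1.
  by rewrite subr0 mulr0 addr0 sub0r add0r.
- have -> : n.+1%:Z - 1 = n by lia.
  by rewrite /= coefD coefMX coefC /= mulr0 !addr0.
- have -> : Negz n - 1 = Negz n.+1 by lia.
  rewrite /= !subr0 /pmulf mulrDl linearD -mulrA -exprS mul_polyC linearZ /=.
  by rewrite mulrN opprD.
Qed.

Lemma stieltjes_deriv p m : fs_deriv (stieltjes (pmulf p u)) m =
  stieltjes (derivf (pmulf p u)) m.
Proof.
rewrite /fs_deriv /derivf /pmulf; case: m => [n|[|n]].
- have -> : n%:Z + 1 = n.+1 by lia.
  by rewrite /= mulr0.
- by rewrite /= mulr0 derivC mulr0 linear0 !oppr0.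
have -> : Negz n.+1 + 1 = Negz n by lia.
rewrite /= derivXn -scaler_nat -scalerAr linearZ /= NegzE mulrNz.
by rewrite mulrNN opprK.
Qed.

(** Phi S' = (Phi S)' - Phi' S. By [stieltjes_pmul] the series Phi S is that
of Phi u up to a polynomial, its derivative is the series of D(Phi u) = Psi u,
and this is Psi S up to a polynomial again. *)
Lemma stieltjes_pearson Phi Psi : pearson u Phi Psi ->
  fs_pmul Phi (fs_deriv (stieltjes u)) =1
  fs_add (fs_pmul (Psi - deriv Phi) (stieltjes u))
         (fs_poly (assoc_poly Psi - deriv (assoc_poly Phi))).
Proof.
move=> pe m.
have -> : fs_pmul Phi (fs_deriv (stieltjes u)) m =
  fs_deriv (fs_pmul Phi (stieltjes u)) m - fs_pmul (deriv Phi) (stieltjes u) m.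
  by rewrite fs_deriv_pmul addrC addKr.
rewrite /fs_add fs_pmulB addrAC; congr (_ - _).
have -> : fs_deriv (fs_pmul Phi (stieltjes u)) m =
   fs_deriv (stieltjes (pmulf Phi u)) m - fs_poly (deriv (assoc_poly Phi)) m.
  rewrite {1}/fs_deriv stieltjes_pmul mulrBr; congr (_ - _).
  case: m => n.
    have -> : n%:Z + 1 = n.+1 by lia.
    by rewrite /= coef_deriv -pmulrn mulr_natl.
  case: n => [|n]; first by rewrite /= mul0r.
  have -> : Negz n.+1 + 1 = Negz n by lia.
  by rewrite /= mulr0.
rewrite stieltjes_deriv stieltjes_pmul.
have -> : stieltjes (derivf (pmulf Phi u)) m = stieltjes (pmulf Psi u) m.
  by case: m => n //=; rewrite pe.
case: m => n /=; last by rewrite !subr0 addr0.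
by rewrite coefB; ring.
Qed.

(** Two Pearson equations for the same regular functional are proportional:
Phi1 C = Phi C1, because the difference multiplies u to zero, and then Phi1 D
= Phi D1, because the series S cancels. So if C and D are coprime, Phi divides
Phi1. *)
Lemma pearson_dvd Phi Psi Phi1 Psi1 a b : regular u ->
  pearson u Phi Psi -> pearson u Phi1 Psi1 ->
  a * (Psi - deriv Phi) + b * (assoc_poly Psi - deriv (assoc_poly Phi)) = 1 ->
  exists h : {poly F}, Phi1 = Phi * h.
Proof.
move=> reg pe pe1 bez.
set C := Psi - deriv Phi in bez *; set D := assoc_poly Psi - _ in bez *.
pose C1 := Psi1 - deriv Phi1; pose D1 := assoc_poly Psi1 - deriv (assoc_poly
  Phi1).
have eC : Phi1 * C = Phi * C1.
  apply/eqP; rewrite -subr_eq0; apply/eqP; apply: (regular_inj reg) => g.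
  have := pe (Phi1 * g); have := pe1 (Phi * g).
  rewrite /derivf /pmulf !derivM => /eqP; rewrite eqr_oppLR -addr_eq0 -linearD.
  move=> /eqP h1 /eqP; rewrite eqr_oppLR -addr_eq0 -linearD => /eqP h2.
  have : u (Phi * (deriv Phi1 * g + Phi1 * deriv g) + Psi * (Phi1 * g)) -
    u (Phi1 * (deriv Phi * g + Phi * deriv g) + Psi1 * (Phi * g)) = 0.
    by rewrite h1 h2 subrr.
  rewrite -linearB => <-; congr (u _); rewrite /C /C1; ring.
have eD : Phi1 * D = Phi * D1.
  apply: fs_poly_inj => m; rewrite -!fs_pmul_poly.
  have h := fs_pmul_ext Phi1 (stieltjes_pearson pe) m.
  have h1 := fs_pmul_ext Phi (stieltjes_pearson pe1) m.
  rewrite -/C -/D -/C1 -/D1 in h h1.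
  rewrite fs_pmul_add -!fs_pmulA in h; rewrite fs_pmul_add -!fs_pmulA in h1.
  rewrite mulrC h1 -eC in h.
  by apply/esym/(addrI (fs_pmul (Phi1 * C) (stieltjes u) m)).
exists (a * C1 + b * D1).
rewrite -[LHS]mulr1 -bez; transitivity (a * (Phi1 * C) + b * (Phi1 * D));
  first by ring.
by rewrite eC eD; ring.
Qed.
End Series.

(** * Pearson equation, Stieltjes equation and class *)

Section Sieved.
Variable F : numFieldType.
Variables (la : F) (k : nat).
Hypothesis k0 : (0 < k)%N.
Hypothesis hla : forall n, 2 * la + n.+1%:R != 0.
Implicit Types (u v : {scalar {poly F}}).

Let Phi : {poly F} := (1 - 'X^2) * chebU_monic F (k - 1).
Let Psi : {poly F} := (- (k%:R * (2 * la + 1))) *: chebT_monic F k.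
Let s : F := 2 ^- (k - 1).

Lemma monic_scale_neq0 n : (2 ^- n : F) != 0.
Proof. by rewrite invr_eq0 expf_neq0 // pnatr_eq0. Qed.

Lemma chebU_monicE : chebU_monic F (k - 1) = s *: chebUp F k.
Proof. by rewrite /chebU_monic -/s; case: (k) k0 => // m _; rewrite subn1. Qed.

Lemma chebT_monicE : chebT_monic F k = s *: chebT F k.
Proof.
rewrite /chebT_monic /s; case: (k) k0 => // m _.
have -> : 1 - m.+1%:Z = - m%:Z by lia.
by rewrite subn1 /= exprnN.
Qed.

Lemma PhiE : Phi = s *: ((1 - 'X^2) * chebUp F k).
Proof. by rewrite /Phi chebU_monicE scalerAr. Qed.

Lemma PsiE : Psi = s *: (- (k%:R * (2 * la + 1)) *: chebT F k).
Proof. by rewrite /Psi chebT_monicE !scalerA mulrC. Qed.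

(** The Pearson equation holds as soon as it holds at every T_n, and there the
product formulas turn it into a relation between the values at T_(n-k) and
T_(n+k). *)
Lemma pearson_of_cheb v (mu : nat -> F) :
  (forall n, v (chebT F n) = mu n) ->
  (forall n, (n%:R - k%:R * (2 * la + 1)) * mu `|n%:Z - k%:Z|%N =
             (n%:R + k%:R * (2 * la + 1)) * mu (n + k)%N) ->
  pearson v Phi Psi.
Proof.
move=> vT hmu q; rewrite /derivf /pmulf.
apply/eqP; rewrite eqr_oppLR -addr_eq0; apply/eqP.
have two0 : (2 : F) != 0 by rewrite pnatr_eq0.
move: q; apply: (graded_all (size_chebT F)) => [|a f g hf hg|i].
- by rewrite deriv0 !mulr0 linear0 addr0.
- rewrite derivD derivZ !mulrDr !linearD -!scalerAr !linearZ /=.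
  have -> : a * v (Phi * deriv f) + v (Phi * deriv g) +
     (a * v (Psi * f) + v (Psi * g)) =
     a * (v (Phi * deriv f) + v (Psi * f)) + (v (Phi * deriv g) + v (Psi * g)).
    by ring.
  by rewrite hf hg mulr0 addr0.
apply: (mulfI two0); rewrite mulr0.
have -> : 2 * (v (Phi * deriv (chebT F i)) + v (Psi * chebT F i)) =
  v (2 *: (Phi * deriv (chebT F i)) + 2 *: (Psi * chebT F i)).
  by rewrite linearD !linearZ /= mulrDr.
have -> : 2 *: (Phi * deriv (chebT F i)) + 2 *: (Psi * chebT F i) =
  s *: (i%:R *: (chebTz F (i%:Z - k%:Z) - chebTz F (i%:Z + k%:Z)) -
   (k%:R * (2 * la + 1)) *: (chebTz F (i%:Z + k%:Z) + chebTz F (i%:Z - k%:Z))).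
  rewrite -chebT_mul PhiE PsiE -!mul_polyC.
  rewrite -chebUp_deriv_chebT /chebTz /= [polyC (- _)]rmorphN /=; ring.
rewrite linearZ /= linearB !linearZ /= linearB linearD /= /chebTz !vT.
have -> : `|(i%:Z + k%:Z)%R|%N = (i + k)%N by lia.
apply/eqP; rewrite mulf_eq0; apply/orP; right; rewrite subr_eq0; apply/eqP.
have := hmu i; set x := mu `|_|%N; set y := mu (i + k)%N; move=> e; apply/eqP;
  rewrite -subr_eq0; apply/eqP.
transitivity ((i%:R - k%:R * (2 * la + 1)) * x - (i%:R + k%:R * (2 * la +
  1)) * y).
  by ring.
by rewrite e subrr.
Qed.

Lemma sieved_functional : exists v, forall n, v (chebT F n) =
  cheb_moment la k n.
Proof. exact: (functional_of_values _ (size_chebT F)). Qed.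

(** The c_n have one element in each degree, and u and u 1 * v agree on them. *)
Lemma functional_unique u v : v 1 = 1 ->
  (forall n, u (sieved_poly la k n.+1) = 0) ->
  (forall n, v (sieved_poly la k n.+1) = 0) ->
  forall q, u q = u 1 * v q.
Proof.
move=> v1 uc vc q.
move: q; apply: (graded_all (size_sieved_poly k0 hla)).
- by rewrite !linear0 mulr0.
- by move=> a f g hf hg; rewrite !linearP /= hf hg; ring.
- by case=> [|i]; rewrite ?v1 ?mulr1 // uc vc mulr0.
Qed.

Section AnyFunctional.
Variable u : {scalar {poly F}}.
Hypothesis uc : forall n, u (sieved_poly la k n.+1) = 0.

Lemma u_cheb n : u (chebT F n) = u 1 * cheb_moment la k n.
Proof.
have [v vT] := sieved_functional.
have v1 : v 1 = 1 by rewrite -(cheb_moment0 la k) -vT.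
by rewrite (functional_unique v1 uc (v_sieved_poly k0 hla vT)) vT.
Qed.

Lemma sieved_pearson : pearson u Phi Psi.
Proof.
apply: (pearson_of_cheb u_cheb) => n.
by rewrite mulrCA cheb_moment_rec // mulrCA.
Qed.

Lemma u_cheb_low n : (0 < n < 2 * k)%N -> u (chebT F n) = 0.
Proof.
move=> /andP[n0 nk]; rewrite u_cheb /cheb_moment ifF ?mulr0 //.
by apply/negP => /(dvdn_leq n0); lia.
Qed.

(** Both sides satisfy the Chebyshev recurrence in n as long as u kills the
T_j with 0 < j <= k that appear as constant terms in [assoc_polyMX]. *)
Lemma assoc_poly_cheb n : (n <= k.+1)%N -> assoc_poly u (chebT F n) =
  u 1 *: chebUp F n.
Proof.
elim/nat_ind2: n => [||n IH0 IH1] hn.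
- by rewrite assoc_polyC scaler0.
- by rewrite /= -['X]mul1r assoc_polyMX assoc_polyC mul0r add0r alg_polyC.
have -> : chebT F n.+2 = 2 *: (chebT F n.+1 * 'X) - chebT F n.
  by rewrite /= -mul_polyC; ring.
have gen p q : assoc_poly u (2 *: (p * 'X) - q) =
    2 *: (assoc_poly u p * 'X + (u p)%:P) - assoc_poly u q.
  by rewrite linearB linearZ /= assoc_polyMX.
rewrite gen u_cheb_low; last lia.
rewrite addr0 IH0 ?IH1; try lia.
rewrite chebUp_rec -!mul_polyC; ring.
Qed.

Lemma sieved_stieltjes_C : Psi - deriv Phi =
  'X * chebU_monic F (k - 1) - (2 * k%:R * la) *: chebT_monic F k.
Proof.
rewrite PhiE PsiE chebU_monicE chebT_monicE derivZ.
have := deriv_Phi F k.-1; rewrite prednK // => ->.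
rewrite -!mul_polyC !(rmorphN, rmorphM, rmorphD) /=; ring.
Qed.

(** 2 (1 - x^2) U_(k-1) = T_(k-1) - T_(k+1), whose associated polynomial is
u_0 (U_(k-2) - U_k) = - 2 u_0 T_k, with derivative - 2 k u_0 U_(k-1). *)
Lemma sieved_stieltjes_D : assoc_poly u Psi - deriv (assoc_poly u Phi) =
  (- (2 * k%:R * la * u 1)) *: chebU_monic F (k - 1).
Proof.
have two0 : (2 : F) != 0 by rewrite pnatr_eq0.
have e : assoc_poly u ((1 - 'X^2) * chebUp F k) = - (u 1 *: chebT F k).
  apply: (scalerI two0); rewrite -linearZ /=.
  have -> : 2 *: ((1 - 'X^2) * chebUp F k) = 2%:P * (1 - 'X^2) * chebUp F k.
    by rewrite -mul_polyC mulrA.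
  rewrite chebT_sub; have -> : k%:Z - 1 = k.-1 by lia.
  have -> : k%:Z + 1 = k.+1 by lia.
  rewrite linearB /= /chebTz /= [assoc_poly u (chebT F k.-1)]assoc_poly_cheb;
    last lia.
  have -> : (if k is m.+1 then 2%:P * 'X * chebT F k - chebT F m else 'X) =
    chebT F k.+1 by case: (k).
  rewrite assoc_poly_cheb //.
  have := chebUp_sub F k.-1; rewrite prednK // => h.
  have -> : chebUp F k.+1 = chebUp F k.-1 + 2%:P * chebT F k
    by rewrite -h; ring.
  rewrite -!mul_polyC; ring.
rewrite PhiE PsiE chebU_monicE !linearZ /= e assoc_poly_cheb // derivN derivZ
  deriv_chebT.
rewrite -!mul_polyC !(rmorphN, rmorphM, rmorphD) /=; ring.
Qed.

Lemma sieved_stieltjes : fs_pmul Phi (fs_deriv (stieltjes u)) =1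
  fs_add (fs_pmul ('X * chebU_monic F (k - 1)
                   - (2 * k%:R * la) *: chebT_monic F k) (stieltjes u))
         (fs_poly ((- (2 * k%:R * la * u 1)) *: chebU_monic F (k - 1))).
Proof. by move=> m; rewrite (stieltjes_pearson sieved_pearson)
  sieved_stieltjes_C sieved_stieltjes_D. Qed.

Lemma size_chebUp : size (chebUp F k) = k.
Proof. by case: (k) k0 => // m _; rewrite size_chebU. Qed.

Lemma size_one_sub_X2 : size (1 - 'X^2 : {poly F}) = 3%N.
Proof. by rewrite addrC size_polyDl size_polyN size_polyXn // size_poly1. Qed.

Lemma size_Phi : size Phi = k.+2.
Proof.
have V0 : chebUp F k != 0 by rewrite -size_poly_gt0 size_chebUp.
rewrite PhiE size_scale ?monic_scale_neq0 //.
by rewrite size_mul ?one_sub_X2_neq0 // size_one_sub_X2 size_chebUp.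
Qed.

Lemma size_Psi : size Psi = k.+1.
Proof.
rewrite PsiE !size_scale ?monic_scale_neq0 ?size_chebT //.
by rewrite oppr_eq0 mulf_neq0 ?pnatr_eq0 -?lt0n //; exact: (hla 0).
Qed.

(** D is a nonzero multiple of U_(k-1), and modulo U_(k-1) the polynomial C is
a nonzero multiple of T_k, so [cheb_pell] provides the Bezout coefficients
required by [pearson_dvd]. Any admissible Phi1 is then a multiple of Phi, of
degree at least k + 1. *)
Lemma sieved_class_ge Phi1 Psi1 : la != 0 -> u 1 != 0 -> regular u ->
  semiclassical_pair u Phi1 Psi1 -> (k - 1 <= pair_class Phi1 Psi1)%N.
Proof.
move=> la0 u10 reg [P1 _ pe1].
have [ka kaE] : exists ka, 2 * k%:R * la = ka by eexists.
have ka0 : ka != 0 by rewrite -kaE !mulf_neq0 ?pnatr_eq0 -?lt0n.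
have s0 : s != 0 := monic_scale_neq0 _.
pose T := chebT F k; pose V := chebUp F k.
(* The coefficients come from T = (s X V - C) / ka, substituted once in T^2. *)
pose b := (- (ka * u 1 * s)^-1) *: ((ka^-1) *: (T * 'X) + (1 - 'X^2) * V).
have bez : - (ka * s)^-1 *: T * (Psi - deriv Phi) +
     b * (assoc_poly u Psi - deriv (assoc_poly u Phi)) = 1.
  rewrite sieved_stieltjes_C sieved_stieltjes_D chebU_monicE chebT_monicE kaE
    -/T -/V.
  transitivity (T ^+ 2 + (1 - 'X^2) * V ^+ 2); last exact: cheb_pell.
  rewrite /b -!mul_polyC !(rmorphN, rmorphM) /=.
  have e1 : (s^-1)%:P * s%:P = 1 :> {poly F} by rewrite -rmorphM mulVf.
  have e2 : (ka^-1)%:P * ka%:P = 1 :> {poly F} by rewrite -rmorphM mulVf.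
  have e3 : ((u 1)^-1)%:P * (u 1)%:P = 1 :> {poly F} by rewrite -rmorphM mulVf.
  rewrite !invfM !rmorphM /=.
  transitivity (((ka^-1)%:P * ka%:P) * ((s^-1)%:P * s%:P) * T ^+ 2 -
     (ka^-1)%:P * ((s^-1)%:P * s%:P) * 'X * V * T
     + ((ka^-1)%:P * ka%:P) * (((u 1)^-1)%:P * (u 1)%:P) * ((s^-1)%:P * s%:P) *
       ((ka^-1)%:P * T * 'X * V + (1 - 'X^2) * V ^+ 2)); first by ring.
  by rewrite e1 e2 e3; ring.
have [g eg] := pearson_dvd reg sieved_pearson pe1 bez.
rewrite /pair_class leq_max; apply/orP; left.
have : (size Phi <= size Phi1)%N by rewrite dvdp_leq // eg dvdp_mulr.
rewrite size_Phi; lia.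
Qed.

End AnyFunctional.

Lemma sieved_semiclassical : la != 0 -> semiclassical_OPS (sieved_poly la k) (k
  - 1).
Proof.
move=> la0; have [v vT] := sieved_functional.
have ops := sieved_OPS k0 hla vT.
have reg : regular v by exists (sieved_poly la k).
have v1 : v 1 = 1 by rewrite -(cheb_moment0 la k) -vT.
have vc := v_sieved_poly k0 hla vT.
exists v; split=> //; split=> //.
  exists Phi, Psi; split; last by rewrite /pair_class size_Phi size_Psi /=; lia.
  split; first by rewrite -size_poly_gt0 size_Phi.
    by rewrite size_Psi.
  exact: sieved_pearson.
move=> Phi1 Psi1; apply: sieved_class_ge => //.
by rewrite v1 oner_neq0.
Qed.

End Sieved.

(** * The limit at a root of unity *)

Section Limit.
Import numFieldNormedType.Exports.
Local Open Scope classical_set_scope.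
Variable R : realType.
Implicit Types (z w a b : R[i]) (s t : R).

Lemma cvg_complex (T : Type) (FF : set_system T) (HF : Filter FF)
    (f g : T -> R) (a b : R) :
  f x @[x --> FF] --> a -> g x @[x --> FF] --> b ->
  ((f x +i* g x)%C : R[i]^o) @[x --> FF] --> ((a +i* b)%C : R[i]^o).
Proof.
move=> fa gb; apply/cvgrPdist_lt => e e0.
have [r r0 ->] : exists2 r : R, 0 < r & e = r%:C%C.
  move: e0; case: e => r i; rewrite ltcE /= => /andP[/eqP -> r0]; by exists r.
have r20 : 0 < r / 2 by rewrite divr_gt0.
near=> x.
have h1 : `|a - f x| < r / 2 by near: x; move/cvgrPdist_lt: fa; apply.
have h2 : `|b - g x| < r / 2 by near: x; move/cvgrPdist_lt: gb; apply.
have -> : (a +i* b)%C - (f x +i* g x)%C = (a - f x)%:C%C + (0 +i* (b - g x))%C.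
  by apply/eqP; rewrite eq_complex /= addr0 add0r !eqxx.
apply: le_lt_trans (ler_normD _ _) _.
rewrite !normc_def /= expr0n /= addr0 add0r !sqrtr_sqr -rmorphD ltcR.
by rewrite (splitr r) ltrD.
Unshelve. all: by end_near.
Qed.

Lemma cvg_near_eq (T : Type) (FF : set_system T) (HF : Filter FF)
  (f g : T -> R[i]^o) (l : R[i]^o) :
  (\forall x \near FF, f x = g x) -> f x @[x --> FF] --> l ->
    g x @[x --> FF] --> l.
Proof.
move=> fg; apply: cvg_trans; apply: near_eq_cvg.
by apply: filterS fg => x /= ->.
Qed.

Lemma cexpD z w : cexp (z + w) = cexp z * cexp w.
Proof.
case: z w => [x y] [x' y']; rewrite /cexp /= expRD cosD sinD.
by apply/eqP; rewrite eq_complex /=; apply/andP; split; apply/eqP; ring.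
Qed.

Lemma cexp0 : cexp (0 : R[i]) = 1.
Proof. by rewrite /cexp /= expR0 cos0 sin0 mul1r. Qed.

Lemma cexpX z n : cexp z ^+ n = cexp (n%:R * z).
Proof.
elim: n => [|n IH]; first by rewrite mul0r cexp0.
by rewrite exprS IH -cexpD -natr1; congr cexp; ring.
Qed.

Lemma expi_rootX k n :
  expi_root R k ^+ n = (cos (n%:R * (2 * pi / k%:R)) +i* sin (n%:R * (2 * pi /
    k%:R)))%C.
Proof.
rewrite /expi_root cexpX /cexp.
have -> : n%:R * (0 +i* (2 * pi / k%:R))%C =
  (0 +i* (n%:R * (2 * pi / k%:R)))%C :> R[i].
  rewrite -(rmorph_nat (@real_complex R) n).
  by apply/eqP; rewrite eq_complex /= !(mulr0, mul0r, subr0, addr0) !eqxx.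
by rewrite /= expR0 mul1r.
Qed.

(** For 0 < r < k the angle pi r / k lies strictly between 0 and pi, so its
sine does not vanish, whereas cos (2 pi r / k) = 1 would force it to. *)
Lemma expi_root_eq1 k n : (0 < k)%N -> (expi_root R k ^+ n == 1) = (k %| n)%N.
Proof.
move=> k0; have kR : k%:R != 0 :> R by rewrite pnatr_eq0 -lt0n.
have wk : expi_root R k ^+ k = 1.
  rewrite expi_rootX mulrC divfK // mulr_natl cos2pi sin2pi.
  by [].
have wm m : expi_root R k ^+ (m * k) = 1 by rewrite mulnC exprM wk expr1n.
rewrite {1}(divn_eq n k) exprD wm mul1r /dvdn.
have := ltn_mod n k; rewrite k0; move: (n %% k)%N => r rk.
case: r rk => [|r] rk; first by rewrite expr0 eqxx.
apply/negbTE/negP => /eqP; rewrite expi_rootX => -[+ _].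
set x : R := pi * r.+1%:R / k%:R.
have -> : r.+1%:R * (2 * pi / k%:R) = x *+ 2 by rewrite /x; field.
rewrite cos_mulr2n => h.
have : 0 < sin x.
  apply: sin_gt0_pi; rewrite /x; apply/andP; split.
    by rewrite divr_gt0 ?mulr_gt0 ?pi_gt0 ?ltr0n.
  by rewrite ltr_pdivrMr ?ltr0n // ltr_pM2l ?pi_gt0 // ltr_nat.
have := cos2Dsin2 x.
have -> : cos x ^+ 2 = 1 by apply: (mulIf (_ : 2 != 0 :> R));
  rewrite ?pnatr_eq0 //; move: h; rewrite -mulr_natr => /eqP;
  rewrite subr_eq => /eqP ->; rewrite mul1r.
move=> /eqP; rewrite addrC -subr_eq0 addrK sqrf_eq0 => /eqP ->.
by rewrite ltxx.
Qed.

Lemma cexp_real z t : cexp (z * t%:C%C) =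
  ((expR (complex.Re z * t) * cos (complex.Im z * t)) +i*
   (expR (complex.Re z * t) * sin (complex.Im z * t)))%C.
Proof.
case: z => x y; rewrite /cexp /= !(mulr0, subr0, add0r).
by apply/eqP; rewrite eq_complex /= !(mul0r, mulr0, subr0, addr0) !eqxx.
Qed.

Lemma is_derive0_cvg (g : R -> R) (x : R) : is_derive (0 : R) 1 g x ->
  (g t - g 0) / t @[t --> (0 : R)^'] --> x.
Proof.
case=> dg <-; apply: cvg_trans dg.
rewrite (_ : (fun t => (g t - g 0) / t) =
  (fun t => t^-1 *: ((g \o shift 0) (t *: 1) - g 0))) //.
by apply/funext => t; rewrite /= addr0 /GRing.scale /= mulr1 mulrC.
Qed.

(** The derivative of cexp (z t) at t = 0 along the real line, computed on
real and imaginary parts. *)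
Lemma cvg_cexp_quot z :
  ((cexp (z * t%:C%C) - 1) / t%:C%C : R[i]^o)
    @[t --> (0 : R)^'] --> (z : R[i]^o).
Proof.
case: z => x y.
pose g (t : R) := expR (x * t) * cos (y * t).
pose h (t : R) := expR (x * t) * sin (y * t).
have dl (z : R) : is_derive (0 : R) 1 (fun t => z * t) z.
  by apply: (is_derive_eq (is_deriveZ z (is_derive_id (0 : R) 1)));
    exact: mulr1.
have de : is_derive (0 : R) 1 (expR \o (fun t => x * t)) x.
  have := is_derive1_comp (is_derive_expR (x * 0)) (dl x).
  by rewrite mulr0 expR0 mul1r.
have dc : is_derive (0 : R) 1 (@cos R \o (fun t => y * t)) 0.
  have := is_derive1_comp (is_derive_cos (y * 0)) (dl y).
  by rewrite mulr0 sin0 oppr0 mul0r.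
have ds : is_derive (0 : R) 1 (@sin R \o (fun t => y * t)) y.
  have := is_derive1_comp (is_derive_sin (y * 0)) (dl y).
  by rewrite mulr0 cos0 mul1r.
have dg : is_derive (0 : R) 1 g x.
  apply: (is_derive_eq (is_deriveM de dc)); rewrite /GRing.scale /=.
  by rewrite !mulr0 cos0 add0r mul1r.
have dh : is_derive (0 : R) 1 h y.
  apply: (is_derive_eq (is_deriveM de ds)); rewrite /GRing.scale /=.
  by rewrite !mulr0 expR0 sin0 mul0r addr0 mul1r.
have cg := is_derive0_cvg dg; have ch := is_derive0_cvg dh.
have HF : Filter ((0 : R)^') by typeclasses eauto.
have H := cvg_complex HF cg ch.
apply: (cvg_near_eq HF _ H).
near=> t.
have t0 : t != 0 by near: t; exact: nbhs_dnbhs_neq.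
rewrite cexp_real /= -/(g t) -/(h t).
have -> : g 0 = 1 by rewrite /g !mulr0 expR0 cos0 mulr1.
have -> : h 0 = 0 by rewrite /h !mulr0 sin0 mulr0.
rewrite -fmorphV.
by apply/eqP; rewrite eq_complex /= !(mulr0, subr0, addr0, add0r) !eqxx.
Unshelve. all: by end_near.
Qed.

Lemma left1_filter : Filter ((1 : R)^'-).
Proof. by typeclasses eauto. Qed.

(** Convergence to the punctured neighbourhood, as difference quotients in ln
s are going to be composed with it. *)
Lemma cvg_ln_left1 : ln s @[s --> (1 : R)^'-] --> (0 : R)^'.
Proof.
have c : ln s @[s --> (1 : R)^'-] --> (0 : R).
  have := @continuous_ln R 1 ltr01; rewrite /prop_for /continuous_at ln1 => H.
  exact: cvg_at_left_filter.
move=> A; rewrite /dnbhs /within /= => /c nA.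
have {}nA : \forall s \near (1 : R)^'-, ln s != 0 -> A (ln s) by [].
change (\forall s \near (1 : R)^'-, A (ln s)); near=> s.
have hA : ln s != 0 -> A (ln s) by near: s.
have s1 : s < 1 by near: s; exact: nbhs_left_lt.
have s0 : 0 < s by near: s; apply: nbhs_left_gt; exact: ltr01.
by apply: hA; rewrite ln_eq0 // lt_eqF.
Unshelve. all: by end_near.
Qed.

Lemma cvg_cpow_quot z :
  ((cpow s z - 1) / (ln s)%:C%C : R[i]^o) @[s --> (1 : R)^'-] --> (z : R[i]^o).
Proof.
apply: (@cvg_comp _ _ _ (@ln R) (fun t => (cexp (z * t%:C%C) - 1) / t%:C%C :
  R[i]^o)).
  exact: cvg_ln_left1.
exact: cvg_cexp_quot.
Qed.

Lemma cvg_ln_complex : ((ln s)%:C%C : R[i]^o)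
    @[s --> (1 : R)^'-] --> (0 : R[i]^o).
Proof.
apply: (cvg_complex left1_filter (f := @ln R) (g := fun=> 0) (a := 0) (b :=
  0)); last exact: cvg_cst.
exact: cvg_trans cvg_ln_left1 (cvg_within _).
Qed.

Lemma cvg_cpow z : (cpow s z : R[i]^o) @[s --> (1 : R)^'-] --> (1 : R[i]^o).
Proof.
have := cvgD (cvgM (@cvg_cpow_quot z) cvg_ln_complex) (cvg_cst (1 : R[i]^o)).
rewrite mulr0 add0r => /(_ left1_filter left1_filter left1_filter) H.
apply: (cvg_near_eq left1_filter _ H).
near=> s.
have l0 : (ln s)%:C%C != 0 :> R[i].
  have s1 : s < 1 by near: s; exact: nbhs_left_lt.
  have s0 : 0 < s by near: s; apply: nbhs_left_gt; exact: ltr01.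
  by rewrite eq_complex /= eqxx andbT ln_eq0 // lt_eqF.
by rewrite /= divfK // subrK.
Unshelve. all: by end_near.
Qed.

(** For w = 1 numerator and denominator both vanish at s = 1, and the quotient
of their derivatives in ln s is b / a; otherwise both tend to 1 - w != 0. *)
Lemma cvg_ratio a b w : (w = 1 -> a != 0) ->
  ((1 - cpow s a * w)^-1 * (1 - cpow s b * w) : R[i]^o) @[s --> (1 : R)^'-] -->
  ((if w == 1 then b / a else 1) : R[i]^o).
Proof.
case: (w =P 1) => [-> /(_ erefl) a0|/eqP w1 _].
  have := cvgM (cvgV a0 (@cvg_cpow_quot a)) (@cvg_cpow_quot b).
  rewrite [_^-1 * _]mulrC => /(_ left1_filter left1_filter) H.
  apply: (cvg_near_eq left1_filter _ H).
  near=> s.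
  have l0 : (ln s)%:C%C != 0 :> R[i].
    have s1 : s < 1 by near: s; exact: nbhs_left_lt.
    have s0 : 0 < s by near: s; apply: nbhs_left_gt; exact: ltr01.
    by rewrite eq_complex /= eqxx andbT ln_eq0 // lt_eqF.
  rewrite /= !mulr1 invfM invrK -mulrA (mulrCA _ (_ - 1)) divff // mulr1.
  by rewrite -[1 - cpow s a]opprB -[1 - cpow s b]opprB invrN mulrNN.
have c z : (1 - cpow s z * w : R[i]^o) @[s --> (1 : R)^'-] --> (1 - w : R[i]^o).
  rewrite -[X in 1 - X]mul1r; apply: cvgB; first exact: cvg_cst.
  by apply: cvgM; [exact: cvg_cpow|exact: cvg_cst].
have w0 : 1 - w != 0 by rewrite subr_eq0 eq_sym.
have := cvgM (cvgV w0 (c a)) (c b); rewrite mulVf // => /(_ left1_filter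
  left1_filter) H.
exact: H.
Unshelve. all: by end_near.
Qed.


Lemma cpow_exp z s n : cpow s z ^+ n = cpow s (n%:R * z).
Proof. by rewrite /cpow cexpX mulrA. Qed.

Lemma cpow_mul z w s : cpow s z * cpow s w = cpow s (z + w).
Proof. by rewrite /cpow -cexpD mulrDl. Qed.

Lemma cpow1 s : 0 < s -> cpow s 1 = s%:C%C.
Proof.
by move=> s0; rewrite /cpow cexp_real /= mul1r mul0r cos0 sin0 mulr0 mulr1 lnK.
Qed.

Section LimitPolynomials.
Variables (la : R[i]) (k : nat).
Hypothesis k0 : (0 < k)%N.
Hypothesis hla : forall n, 2 * la + n.+1%:R != 0.
Let om := expi_root R k.
Let be s := cpow s (la * k%:R).
Let q s := s%:C%C * om.

Lemma be_qX s j n : 0 < s ->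
  be s ^+ j * q s ^+ n = cpow s (j%:R * (la * k%:R) + n%:R) * om ^+ n.
Proof.
move=> s0; have -> : q s ^+ n = cpow s n%:R * om ^+ n.
  by rewrite /q -(cpow1 s0) [LHS]exprMn cpow_exp mulr1.
have -> : be s ^+ j = cpow s (j%:R * (la * k%:R)) by exact: cpow_exp.
by rewrite mulrA cpow_mul.
Qed.

Lemma cvg_sieved_coef n j : (0 < n)%N ->
  ((1 - be s ^+ 2 * q s ^+ n)^-1 * (1 - be s ^+ j * q s ^+ n) : R[i]^o)
    @[s --> (1 : R)^'-] -->
  ((if (k %| n)%N then (j%:R * la + (n %/ k)%:R) / (2 * la + (n %/ k)%:R)
    else 1) : R[i]^o).
Proof.
move=> n0; set a := 2%:R * (la * k%:R) + n%:R;
  set b := j%:R * (la * k%:R) + n%:R.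
have kz : k%:R != 0 :> R[i] by rewrite pnatr_eq0 -lt0n.
have aE c : (k %| n)%N -> c * (la * k%:R) + n%:R =
  k%:R * (c * la + (n %/ k)%:R) :> R[i].
  by move=> d; rewrite -{1}(divnK d) natrM; ring.
have m0 : (k %| n)%N -> 2 * la + (n %/ k)%:R != 0.
  by case: n n0 {a b aE} => // n _ d; have [m ->] := divnk_pos k0 d.
have a0 : om ^+ n = 1 -> a != 0.
  move/eqP; rewrite expi_root_eq1 // => d.
  by rewrite /a aE // mulf_neq0 // m0.
have w1 : (om ^+ n == 1) = (k %| n)%N by exact: expi_root_eq1.
have := @cvg_ratio a b (om ^+ n) a0; rewrite w1.
have -> : (if (k %| n)%N then b / a else 1) =
  (if (k %| n)%N then (j%:R * la + (n %/ k)%:R) / (2 * la +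
    (n %/ k)%:R) else 1).
  by case: ifP => // d; rewrite /a /b !aE // invfM mulrACA divff // mul1r.
move=> H; apply: (cvg_near_eq left1_filter _ H); near=> s.
have s0 : 0 < s by near: s; apply: nbhs_left_gt; exact: ltr01.
by rewrite /= !be_qX.
Unshelve. all: by end_near.
Qed.

Lemma cvg_qultra_norm n x :
  ((qultra_norm (be s) (q s) n).[x] : R[i]^o) @[s --> (1 : R)^'-] -->
  ((sieved_poly la k n).[x] : R[i]^o).
Proof.
have cst (c : R[i]) : ((fun _ : R => c : R[i]^o) s) @[s --> (1 : R)^'-] --> (c
  : R[i]^o).
  exact: cvg_cst.
elim/nat_ind2: n => [||n IH0 IH1].
- by rewrite /= hornerC; exact: cst.
- rewrite /= hornerX.
  have c2 : (2 : R[i]) != 0 by rewrite pnatr_eq0.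
  have e : 2 * (1 + 1)^-1 * x = x by rewrite -[1 + 1]/(2%:R) divff // mul1r.
  rewrite (_ : (fun s => _) = (fun s => 2 * (1 + be s)^-1 * x)); last first.
    by apply/funext => s; rewrite hornerZ hornerX.
  suff H : ((2 * (1 + be s)^-1 * x : R[i]^o) @[s --> (1 : R)^'-] -->
    (2 * (1 + 1)^-1 * x : R[i]^o)) by rewrite e in H.
  apply: cvgM; last exact: cst.
  apply: cvgM; first exact: cst.
  apply: cvgV; first exact: c2.
  apply: cvgD; first exact: cst.
  exact: cvg_cpow.
pose r (j : nat) (s : R) : R[i] := (1 - be s ^+ 2 * q s ^+ n.+1)^-1 *
  (1 - be s ^+ j * q s ^+ n.+1).
rewrite (_ : (fun s => _) = (fun s => 2 * r 1%N s * (x * (qultra_norm (be s) (q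
  s) n.+1).[x])
   - r 0%N s * (qultra_norm (be s) (q s) n).[x])); last first.
  apply/funext => s.
  have -> : qultra_norm (be s) (q s) n.+2 = (1 - be s ^+ 2 * q s ^+ n.+1)^-1 *:
        ((2 * (1 - be s * q s ^+ n.+1)) *: ('X * qultra_norm (be s) (q s) n.+1)
         - (1 - q s ^+ n.+1) *: qultra_norm (be s) (q s) n) by [].
  rewrite hornerZ hornerD hornerN !hornerZ hornerM hornerX /r expr0 expr1
    mul1r; ring.
pose l (j : nat) : R[i] := if (k %| n.+1)%N then
   (j%:R * la + (n.+1 %/ k)%:R) / (2 * la + (n.+1 %/ k)%:R) else 1.
have -> : (sieved_poly la k n.+2).[x] = 2 * l 1%N * (x * (sieved_poly la k
  n.+1).[x])
   - l 0%N * (sieved_poly la k n).[x].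
  rewrite sieved_polyS /l; case: ifP => _.
    by rewrite hornerZ hornerD hornerN !hornerZ hornerM hornerX; ring.
  by rewrite hornerD hornerN !hornerM hornerC hornerX; ring.
apply: cvgB; apply: cvgM.
- by apply: cvgM; [exact: cst | exact: cvg_sieved_coef].
- by apply: cvgM; [exact: cst | exact: IH1].
- exact: cvg_sieved_coef.
- exact: IH0.
Qed.

(** The limit polynomial is unique because limits in C are, and a polynomial
is determined by its values. *)
Lemma sieved1E n : sieved1 k la n = sieved_poly la k n.
Proof.
apply: xget_unique => /=.
  by move=> x; exact: cvg_qultra_norm.
move=> c hc; apply/eqP; rewrite -subr_eq0; apply/eqP.
have H x : c.[x] = (sieved_poly la k n).[x].
  apply: (@cvg_unique _ (@norm_hausdorff _ R[i]^o) _ _ _ _ (hc x)).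
  exact: cvg_qultra_norm.
apply: (@roots_geq_poly_eq0 _ _ [seq i%:R | i <- iota 0 (size (c - sieved_poly
  la k n)%R)]).
- by apply/allP => _ /mapP[i _ ->]; rewrite /root !hornerE H subrr.
- by rewrite map_inj_uniq ?iota_uniq // => i j /eqP; rewrite eqr_nat => /eqP.
- by rewrite size_map size_iota.
Qed.

End LimitPolynomials.
End Limit.

(** * The Chebyshev case *)

Section Chebyshev_case.
Variables (F : numFieldType) (k : nat).
Hypothesis k0 : (0 < k)%N.

Lemma sieved_poly_0 n : sieved_poly (0 : F) k n = chebT F n.
Proof.
elim/nat_ind2: n => [||n IH0 IH1] //.
rewrite sieved_polyS IH0 IH1; case: ifP => // d.
have [m ->] := divnk_pos k0 d.
have m0 : (m.+1%:R : F) != 0 by rewrite pnatr_eq0.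
rewrite mulr0 !add0r scalerBr !scalerA mulVf // scale1r mulrCA mulVf // mulr1.
by rewrite /= -mul_polyC mulrA.
Qed.

Lemma sieved_poly_0_classical : classical_OPS (sieved_poly (0 : F) k).
Proof.
have hla n : 2 * 0 + n.+1%:R != 0 :> F by rewrite mulr0 add0r pnatr_eq0.
have [v vT] := sieved_functional (0 : F) k.
have ops := sieved_OPS k0 hla vT.
have vc n : v (chebT F n.+1) = 0 by rewrite -sieved_poly_0;
  exact: v_sieved_poly.
(* For c_n = T_n the Pearson pair with k = 1, namely (1 - x^2, - x), has class
   0. *)
have pe := @pearson_of_cheb F 0 1 isT v (fun n => v (chebT F n)) (fun=> erefl).
exists v; split=> //; split=> //; first by exists (sieved_poly (0 : F) k).
do 2 eexists; split.
  split; last first.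
  - apply: pe => n; rewrite addn1 vc mulr0 mulr0 add0r mul1r.
    case: n => [|[|n]].
    + by rewrite (vc 0) mulr0.
    + by rewrite subrr mul0r.
    + by rewrite [X in chebT F X](_ : _ = n.+1) ?vc ?mulr0 //; lia.
  - by rewrite size_Psi.
  - by rewrite -size_poly_gt0 size_Phi.
by rewrite /pair_class size_Phi // size_Psi.
Qed.
End Chebyshev_case.

Theorem theorem5p1 (R : realType) (k : nat) (lambda : R[i])
    (p : nat -> {poly R[i]}) :
  (3 <= k)%N ->
  (forall n : nat, (1 <= n)%N -> lambda <> - (n%:R / 2)) ->
  p 0%N = 1 ->
  (forall n j : nat, (j <= k - 1)%N ->
     p (k * n + j + 1)%N =
       (pochhammer (1 + 2 * lambda) n /
          (2 ^+ (k * n + j) * pochhammer (lambda + 1) n))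
       *: sieved1 k lambda (k * n + j + 1)) ->
  let Phi : {poly R[i]} := (1 - 'X^2) * chebU_monic R[i] (k - 1) in
  let Psi : {poly R[i]} :=
    (- (k%:R * (2 * lambda + 1))) *: chebT_monic R[i] k in
  [/\ forall u : {scalar {poly R[i]}}, is_OPS u p ->
        let u0 := u 'X^0 in
        let C : {poly R[i]} :=
          'X * chebU_monic R[i] (k - 1)
          - (2 * k%:R * lambda) *: chebT_monic R[i] k in
        let D : {poly R[i]} :=
          (- (2 * k%:R * lambda * u0)) *: chebU_monic R[i] (k - 1) in
        derivf (pmulf Phi u) =1 pmulf Psi u /\
        fs_pmul Phi (fs_deriv (stieltjes u)) =1
          fs_add (fs_pmul C (stieltjes u)) (fs_poly D),
      (forall n : nat, lambda <> - (n%:R / 2)) ->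
        semiclassical_OPS (sieved1 k lambda) (k - 1)
    & lambda = 0 ->
        (exists a : nat -> R[i], forall n : nat,
            a n <> 0 /\ sieved1 k lambda n = a n *: chebT R[i] n) /\
        classical_OPS (sieved1 k lambda)].
Proof.
move=> k3 hlam p0 hp Phi Psi.
have k0 : (0 < k)%N by exact: leq_trans k3.
have hla n : 2 * lambda + n.+1%:R != 0.
  apply/eqP => h; apply: (hlam n.+1 isT).
  have two0 : (2 : R[i]) != 0 by rewrite pnatr_eq0.
  apply: (mulfI two0); rewrite mulrN mulrCA divff // mulr1.
  by apply/eqP; rewrite -addr_eq0 h.
have sE n : sieved1 k lambda n = sieved_poly lambda k n by apply: sieved1E.
have sEf : sieved1 k lambda = sieved_poly lambda k by apply/funext.
split.
- move=> u [sp orth _] u0 C D.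
  have uc n : u (sieved_poly lambda k n.+1) = 0.
    have hn : (k * (n %/ k) + n %% k + 1)%N = n.+1.
      by rewrite addn1 mulnC -divn_eq.
    have hr : (n %% k <= k - 1)%N by have := ltn_mod n k; lia.
    have := hp (n %/ k)%N (n %% k)%N hr; rewrite hn sE; set a := _ / _ => pn.
    have sa := sp n.+1; have : u (p 0%N * p n.+1) = 0 by exact: orth.
    rewrite p0 mul1r pn; rewrite pn in sa.
    have a0 : a != 0.
      by apply/eqP => e; move: sa; rewrite e scale0r size_poly0.
    by rewrite linearZ => /eqP; rewrite mulf_eq0 (negbTE a0) => /eqP.
  split; first exact: sieved_pearson.
  by have := sieved_stieltjes k0 hla uc; rewrite /D /u0 expr0.
- move=> hl; rewrite sEf; apply: sieved_semiclassical => //.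
  by apply/eqP => l0; apply: (hl 0%N); rewrite l0 mul0r oppr0.
- move=> l0; split.
    exists (fun=> 1) => n; split; first exact/eqP/oner_neq0.
    by rewrite sE l0 sieved_poly_0 // scale1r.
  by rewrite sEf l0; apply: sieved_poly_0_classical.
Qed.
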